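(* Let $\Gamma$ be a finite connected metric graph with $V$ vertices, $E$ edges and total length $\ell(\Gamma)$. In the case of zero potential, for any $\lambda\ge0$, $$\frac{\ell(\Gamma)}{\pi}\sqrt\lambda-E\ \le\ \mathcal{N}(\lambda;-\Delta_{{\rm K},\Gamma})\ \le\ \frac{\ell(\Gamma)}{\pi}\sqrt\lambda+V,$$ where $\mathcal{N}(\lambda;-\Delta_{{\rm K},\Gamma})$ is the number of eigenvalues, counted with multiplicities, of the Krein Laplacian $-\Delta_{{\rm K},\Gamma}$ in $(-\infty,\lambda]$.
   Context: A finite metric graph $\Gamma$ consists of a finite vertex set $\mathcal{V}$, a finite nonempty edge set $\mathcal{E}$ (loops and multiple edges allowed) and a length function $\ell:\mathcal{E}\to(0,\infty)$; $V=|\mathcal{V}|$, $E=|\mathcal{E}|$, $\ell(\Gamma)=\sum_{e\in\mathcal{E}}\ell(e)$. Each edge $e$ is identified with $[0,\ell(e)]$, its two endpoints corresponding to the (possibly equal) vertices incident with $e$. A function $f$ on $\Gamma$ is a collection $(f_e)_{e\in\mathcal{E}}$ of functions $f_e:(0,\ell(e))\to\mathbb{C}$; $f\in L^2(\Gamma)$ means $f_e\in L^2(0,\ell(e))$ for all $e$. $\widetilde H^k(\Gamma)$ is the set of $f\in L^2(\Gamma)$ with $f_e\in H^k(0,\ell(e))$ for all $e$; $H^1(\Gamma)$ is the set of $f\in\widetilde H^1(\Gamma)$ that are continuous at each vertex (all traces at endpoints corresponding to the same vertex $v$ coincide; the common value is $f(v)$). For $f\in\widetilde H^2(\Gamma)$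 and $v\in\mathcal{V}$, $\partial_\nu f(v)$ is the sum, over all edge endpoints located at $v$ (both endpoints of a loop at $v$ are counted), of the derivative of $f_e$ at that endpoint taken in the direction pointing towards $v$ (i.e. $f_e'(\ell(e))$ for the endpoint $\ell(e)$ and $-f_e'(0)$ for the endpoint $0$). Let $S$ be the operator in $L^2(\Gamma)$ with $(Sf)_e=-f_e''$ on each edge and $\operatorname{dom}S=\{f\in\widetilde H^2(\Gamma)\cap H^1(\Gamma): f(v)=\partial_\nu f(v)=0\text{ for each }v\in\mathcal{V}\}$. It is closed, symmetric, densely defined with a positive lower bound; its adjoint $S^*$ acts in the same way on $\operatorname{dom}S^*=\widetilde H^2(\Gamma)\cap H^1(\Gamma)$. The Krein Laplacian $-\Delta_{{\rm K},\Gamma}$ is the Krein–von Neumann extension of $S$: the self-adjoint restriction of $S^*$ to $\operatorname{dom}S\dotplus\ker S^*$. Its spectrum is purely discrete. *)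

(* Defs.v *)
From HB Require Import structures.
From mathcomp Require Import all_boot all_order all_algebra.
From mathcomp Require Import complex.
From mathcomp Require Import all_classical all_reals all_analysis.

Set Implicit Arguments.
Unset Strict Implicit.
Unset Printing Implicit Defensive.

Import Order.TTheory GRing.Theory Num.Theory.
Import numFieldNormedType.Exports.

Local Open Scope classical_set_scope.
Local Open Scope ring_scope.

Section Sobolev.
Context {R : realType}.
Implicit Types (l : R) (f g phi : R -> R) (u v : R -> R[i]).

(* A function on the interval (0, l) is represented by a total function on R;
   its values outside of (0, l) are irrelevant everywhere below. *)

Definition L2 l f : Prop :=
  measurable_fun `]0, l[ f /\
  (@lebesgue_measure R).-integrable `]0, l[ (fun x => (f x ^+ 2)%:E).

Definition test_function l phi : Prop :=
  (forall (n : nat) (x : R), derivable (derive1n n phi) x 1) /\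
  (exists a b : R, [/\ 0 < a, b < l & forall x, x \notin `[a, b] -> phi x = 0]).

Definition is_weak_derivative l f g : Prop :=
  forall phi, test_function l phi ->
    (\int[@lebesgue_measure R]_(x in `]0, l[) (f x * derive1 phi x) =
     - \int[@lebesgue_measure R]_(x in `]0, l[) (g x * phi x))%R.

Fixpoint Sobolev (k : nat) l f : Prop :=
  if k is k'.+1 then
    L2 l f /\ exists g, is_weak_derivative l f g /\ Sobolev k' l g
  else L2 l f.

(* Meaningful, and then unique up to a null set, for f in H^1(0, l). *)
Definition weak_derivative l f : R -> R :=
  xget (fun=> 0) [set g | L2 l g /\ is_weak_derivative l f g].

(* The value at the endpoint a of the continuous representative of f on
   [0, l]; meaningful for f in H^1(0, l). *)
Definition trace l f (a : R) : R :=
  xget 0 [set c | exists g : R -> R,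
    [/\ {within `[0, l], continuous g},
        f = g %[ae (@lebesgue_measure R) in `]0, l[%classic] & g a = c]].

Definition rpart u : R -> R := fun x => complex.Re (u x).
Definition ipart u : R -> R := fun x => complex.Im (u x).

Definition CSobolev (k : nat) l u : Prop :=
  Sobolev k l (rpart u) /\ Sobolev k l (ipart u).

Definition Cweak_derivative l u : R -> R[i] :=
  fun x => Complex (weak_derivative l (rpart u) x)
                   (weak_derivative l (ipart u) x).

Definition Ctrace l u (a : R) : R[i] :=
  Complex (trace l (rpart u) a) (trace l (ipart u) a).

End Sobolev.

(* The edge e is the interval [0, len e]; its endpoints 0 and len e are located
   at the vertices ini e and ter e. *)
Record metric_graph (R : realType) := MetricGraph {
  vertex : finType;
  edge : finType;
  ini : edge -> vertex;
  ter : edge -> vertex;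
  len : edge -> R;
  len_gt0 : forall e, 0 < len e;
  edge_nonempty : (0 < #|edge|)%N
}.

Section MetricGraph.
Context {R : realType} (G : metric_graph R).

Definition adjacent : rel (vertex G) := fun v w =>
  [exists e : edge G, ((ini e == v) && (ter e == w)) ||
                      ((ini e == w) && (ter e == v))].

Definition connected_graph : Prop :=
  forall v w : vertex G, connect adjacent v w.

Definition total_length : R := \sum_(e : edge G) len e.

Definition gfun := edge G -> R -> R[i].
Implicit Types f g h u : gfun.

(* Equality as elements of L^2. *)
Definition gfun_eq f g : Prop :=
  forall e, f e = g e %[ae (@lebesgue_measure R) in `]0, len e[%classic].

Definition edge_Sobolev (k : nat) f : Prop :=
  forall e, CSobolev k (len e) (f e).

Definition vertex_values f (a : vertex G -> R[i]) : Prop :=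
  forall e, Ctrace (len e) (f e) 0 = a (ini e) /\
            Ctrace (len e) (f e) (len e) = a (ter e).

Definition graph_H1 f : Prop :=
  edge_Sobolev 1 f /\ exists a, vertex_values f a.

Definition normal_derivative f (v : vertex G) : R[i] :=
  \sum_(e : edge G | ter e == v)
     Ctrace (len e) (Cweak_derivative (len e) (f e)) (len e) -
  \sum_(e : edge G | ini e == v)
     Ctrace (len e) (Cweak_derivative (len e) (f e)) 0.

Definition minus_second_derivative f : gfun := fun e x =>
  - Cweak_derivative (len e) (Cweak_derivative (len e) (f e)) x.

Definition dom_S f : Prop :=
  [/\ edge_Sobolev 2 f, graph_H1 f, vertex_values f (fun=> 0) &
      forall v, normal_derivative f v = 0].

Definition dom_Sadj f : Prop := edge_Sobolev 2 f /\ graph_H1 f.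

Definition ker_Sadj h : Prop :=
  dom_Sadj h /\ gfun_eq (minus_second_derivative h) (fun _ _ => 0).

Definition dom_Krein f : Prop :=
  dom_Sadj f /\
  exists u h, [/\ dom_S u, ker_Sadj h & gfun_eq f (fun e x => u e x + h e x)].

(* The Krein Laplacian acts on its domain as minus_second_derivative. *)
Definition Krein_eigenspace (mu : R) f : Prop :=
  dom_Krein f /\
  gfun_eq (minus_second_derivative f) (fun e x => (mu%:C)%C * f e x).

Definition L2_independent (n : nat) (F : 'I_n -> gfun) : Prop :=
  forall c : 'I_n -> R[i],
    gfun_eq (fun e x => \sum_(i < n) c i * F i e x) (fun _ _ => 0) ->
    forall i, c i = 0.

Definition L2_dim (P : gfun -> Prop) : \bar R :=
  ereal_sup [set (n%:R)%:E | n in [set n : nat |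
    exists F : 'I_n -> gfun, (forall i, P (F i)) /\ L2_independent F]].

(* The eigenvalues of the self-adjoint Krein Laplacian are real, and a real mu
   which is not an eigenvalue contributes 0. *)
Definition Krein_counting (lambda : R) : \bar R :=
  \esum_(mu in [set mu : R | mu <= lambda]) L2_dim (Krein_eigenspace mu).

End MetricGraph.

(* Main.v *)
Require Import Defs.
From mathcomp Require Import all_boot all_order all_algebra.
From mathcomp Require Import complex.
From mathcomp Require Import all_classical all_reals all_analysis.
From mathcomp Require Import measurable_realfun.
From mathcomp Require Import ring lra.
From mathcomp Require Import zify.
From mathcomp Require Import sesquilinear spectral.

(** The problem is reduced to counting the eigenvalues of one hermitian matrix.

Vertex conditions. If [f = u + h] with [u] in the domain of the minimal
operator and [h] harmonic, then [f] is continuous, [h] is the edgewise affine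
interpolant of the vertex values of [f], and [f] and [h] have the same normal
derivatives. Hence an eigenfunction for mu is a continuous function that solves
[- f'' = mu f] on every edge and whose normal derivative at each vertex equals
that of the affine interpolant of its vertex values
([Krein_data_of_eigenfunction], [eigenfunction_of_Krein_data]).

Sampling. Fix lambda and cut every edge into equal pieces that are shorter than
pi / sqrt lambda. For mu <= lambda a solution on a piece is determined by its
two end values, so an eigenfunction is determined by its values at the vertices
and the cut points. The vectors that arise are the kernel of a hermitian matrix
Q(mu) ([krein_mx]), whose quadratic form at [y] is the energy, the integral of
|f'|^2 - mu |f|^2, of the piecewise solution [f] with values [y], minus the
Dirichlet energy of the edgewise affine interpolant of the vertex values. So
the multiplicity of mu is the dimension of the kernel of Q(mu)
([L2_dim_eigenspace]).

Crossing. The form of Q(mu) strictly decreases in mu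
([hform_krein_mx_decr]), depends continuously on mu in [0, lambda]
([hform_krein_mx_cont]), and is nonnegative for mu = 0
([hform_krein_mx0_ge0]). Each ordered eigenvalue of Q(mu) is therefore
decreasing and vanishes at most once, so at most as many zeros occur as Q has
rows ([crossing_upper]); and each eigenvalue that is nonpositive at lambda has
gone through zero on [0, lambda] ([crossing_lower]).

Choice of the cuts. Let N_e be the integer part of len e * sqrt lambda / pi.
Cutting e into N_e + 1 pieces gives a matrix with V + sum N_e rows, whence the
upper bound. Cutting e into 2 N_e pieces, or not at all when N_e = 0, leaves N_e
cut points of odd rank, each the middle of an interval of length at least pi / sqrt lambda whose ends are of
even rank. On the vectors supported by these points the form is diagonal, with
entries 2 k cot (k h) <= 0 where k = sqrt lambda and h is the length of a piece.
So Q(lambda) has at least sum N_e nonpositive eigenvalues ([npos_lower]), whence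
the lower bound.

Analysis. The domains are defined by weak derivatives and traces, so the first
half of the file shows that they mean what they should: weak derivatives are
unique almost everywhere, and a function with weak second derivative - mu f is
almost everywhere a combination of the two fundamental solutions
([Sobolev2_regular]). The latter holds because the two coefficients, written in
terms of f and of its weak derivative as for a classical solution, have weak
derivative zero, and are therefore constants ([du_Bois_Reymond]). *)

Set Implicit Arguments.
Unset Strict Implicit.
Unset Printing Implicit Defensive.

Import Order.TTheory GRing.Theory Num.Theory.
Import numFieldNormedType.Exports.

Local Open Scope classical_set_scope.
Local Open Scope ring_scope.
Local Open Scope sesquilinear_scope.

(** * Smooth functions *)

Section Smooth.
Context {R : realType}.
Implicit Types (f g : R -> R) (a b c x : R).

Definition smooth f := forall n x, derivable (derive1n n f) x 1.

(** Smoothness by coinduction: it is enough to find a class of derivable functions that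
is stable under derivation. *)
Lemma smooth_class (S : (R -> R) -> Prop) :
  (forall f, S f -> (forall x, derivable f x 1) /\ S (derive1 f)) ->
  forall f, S f -> smooth f.
Proof.
move=> HS f Sf n; suff Sn : S (derive1n n f) by have [] := HS _ Sn.
elim: n => [//|n IH]; rewrite derive1nS.
by have [] := HS _ IH.
Qed.

Lemma smooth_derivable f x : smooth f -> derivable f x 1.
Proof. by move=> /(_ 0%N x). Qed.

Lemma smooth_is_derive f x : smooth f -> is_derive x 1 f (derive1 f x).
Proof. by move=> /(_ 0%N x) ?; rewrite derive1E; exact: DeriveDef. Qed.

Lemma smooth_derive1 f : smooth f -> smooth (derive1 f).
Proof. by move=> sf n x; move: (sf n.+1 x); rewrite /derive1n iterSr. Qed.

Lemma smooth_continuous f : smooth f -> continuous f.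
Proof.
by move=> sf x; apply: differentiable_continuous; apply/derivable1_diffP; exact: smooth_derivable.
Qed.

(** The derivative of a product is a sum of products, so sums and products have to be
handled together to get a class that is stable under derivation. *)
Inductive smooth_alg : (R -> R) -> Prop :=
| smooth_alg_base f of smooth f : smooth_alg f
| smooth_alg_add f g of smooth_alg f & smooth_alg g :
    smooth_alg (fun x => f x + g x)
| smooth_alg_mul f g of smooth_alg f & smooth_alg g :
    smooth_alg (fun x => f x * g x).

Lemma smooth_alg_smooth f : smooth_alg f -> smooth f.
Proof.
apply: smooth_class => {}f; elim=> {f}.
- move=> f sf; split; first by move=> x; exact: smooth_derivable.
  exact/smooth_alg_base/smooth_derive1.
- move=> f g _ [df sf] _ [dg sg]; split=> [x|]; first exact: derivableD.
  rewrite (_ : derive1 _ = fun x => derive1 f x + derive1 g x); first exact: smooth_alg_add.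
  by apply/funext => x; rewrite !derive1E; exact: deriveD.
- move=> f g Sf [df sf] Sg [dg sg]; split=> [x|]; first exact: derivableM.
  rewrite (_ : derive1 _ = fun x => f x * derive1 g x + g x * derive1 f x).
    by apply: smooth_alg_add; apply: smooth_alg_mul.
  by apply/funext => x; rewrite !derive1E; exact: deriveM.
Qed.

Lemma smoothD f g : smooth f -> smooth g -> smooth (fun x => f x + g x).
Proof.
by move=> ? ?; apply/smooth_alg_smooth/smooth_alg_add; exact: smooth_alg_base.
Qed.

Lemma smoothM f g : smooth f -> smooth g -> smooth (fun x => f x * g x).
Proof.
by move=> ? ?; apply/smooth_alg_smooth/smooth_alg_mul; exact: smooth_alg_base.
Qed.

Lemma smooth_cst c : smooth (fun=> c).
Proof.
apply: (@smooth_class (fun f => exists c, f = fun=> c)); last by exists c.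
move=> f [d ->]; split=> [x|]; first exact: derivable_cst.
by exists 0; apply/funext => x; rewrite derive1_cst.
Qed.

Lemma smoothZ c f : smooth f -> smooth (fun x => c * f x).
Proof. by move=> sf; apply: smoothM => //; exact: smooth_cst. Qed.

Lemma smoothN f : smooth f -> smooth (fun x => - f x).
Proof.
by move=> /(@smoothZ (-1)); under eq_fun do rewrite mulN1r.
Qed.

Lemma smoothB f g : smooth f -> smooth g -> smooth (fun x => f x - g x).
Proof. by move=> sf sg; apply: smoothD => //; exact: smoothN. Qed.

Lemma smoothX f n : smooth f -> smooth (fun x => f x ^+ n).
Proof.
move=> sf; elim: n => [|n IH]; first exact: smooth_cst.
by under eq_fun do rewrite exprS; exact: smoothM.
Qed.

Lemma is_derive_affine f a b x d : is_derive (a * x + b) 1 f d ->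
  is_derive x 1 (fun y => f (a * y + b)) (a * d).
Proof.
move=> fd; have h : is_derive x 1 (fun y => a * y + b) a.
  by apply: is_derive_eq; rewrite /GRing.scale/=; ring.
have := @is_derive1_comp R f (fun y => a * y + b) x _ _ fd h.
by rewrite mulrC.
Qed.

Lemma smooth_affine a b f : smooth f -> smooth (fun x => f (a * x + b)).
Proof.
move=> sf.
apply: (@smooth_class (fun g => exists c f,
   smooth f /\ g = fun x => c * f (a * x + b))); last first.
  by exists 1, f; split=> //; apply/funext => x; rewrite mul1r.
move=> _ [c [g [sg ->]]].
have H x : is_derive x 1 (fun x => c * g (a * x + b))
   (c * a * (derive1 g) (a * x + b)).
  have := is_derive_affine (smooth_is_derive (a * x + b) sg).
  move=> h; have := is_deriveZ c h; rewrite /GRing.scale/= => h'.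
  by apply: is_derive_eq; rewrite mulrA.
split=> [x|]; first exact: ex_derive.
exists (c * a), (derive1 g); split; first exact: smooth_derive1.
by apply/funext => x; rewrite derive1E derive_val.
Qed.

End Smooth.

(** * Smooth approximations of the indicator of an interval *)

Section Bump.
Context {R : realType}.
Implicit Types (f g : R -> R) (a b c x : R).

(** Used at 0 for the functions [x ^- n * exp (- 1 / x)] extended by 0. *)
Lemma is_derive_quadratic f C : (forall x, `|f x| <= C * x ^+ 2) ->
  is_derive (0 : R) 1 f 0.
Proof.
move=> fC; have f0 : f 0 = 0.
  by apply/eqP; rewrite -normr_le0 (le_trans (fC 0))// expr0n mulr0.
have H : h^-1 *: (f (h *: (1 : R) + 0) - f 0) @[h --> 0^'] --> (0 : R).
  apply/cvgrPdist_lt => e e0.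
  have C0 : 0 <= C by have := le_trans (normr_ge0 _) (fC 1); rewrite expr1n mulr1.
  near=> h.
  have h0 : h != 0 by near: h; exact: nbhs_dnbhs_neq.
  rewrite f0 subr0 sub0r normrN /GRing.scale/= mulr1 addr0 normrM normfV.
  rewrite mulrC ltr_pdivrMr ?normr_gt0//.
  apply: (le_lt_trans (fC h)).
  rewrite -real_normK ?num_real// expr2 mulrA ltr_pM2r ?normr_gt0//.
  have : `|h| < e / (C + 1).
    near: h; apply: dnbhs0_lt; rewrite divr_gt0// ltr_wpDl//.
  rewrite ltr_pdivlMr ?ltr_wpDl//; apply: le_lt_trans.
  by rewrite mulrC ler_wpM2l// lerDl.
apply: DeriveDef; last by rewrite /derive; apply/cvg_lim.
by apply/cvg_ex; exists 0.
Unshelve. all: by end_near. Qed.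

(** The standard smooth function [exp (- 1 / x)] is the case [n = 0]. The other ones are
there because its derivatives are combinations of them. *)
Definition expinv n x : R := if 0 < x then x ^- n * expR (- x^-1) else 0.

Lemma expinv_ge0 n x : 0 <= expinv n x.
Proof.
by rewrite /expinv; case: ifPn => // x0; rewrite mulr_ge0 ?expR_ge0// invr_ge0 exprn_ge0// ltW.
Qed.

Lemma expinv_quadratic n x : `|expinv n x| <= n.+2`!%:R * x ^+ 2.
Proof.
rewrite ger0_norm ?expinv_ge0// /expinv; case: ifPn => x0; last first.
  by rewrite mulr_ge0// sqr_ge0.
have fact_gt0 : 0 < n.+2`!%:R :> R by rewrite ltr0n fact_gt0.
have h : x^-1 ^+ n.+2 / n.+2`!%:R <= expR x^-1.
  have := @expR_ge1Dxn R x^-1 n.+1; rewrite invr_ge0 => /(_ (ltW x0)).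
  by apply: le_trans; rewrite lerDr.
rewrite ler_pdivrMr// in h.
rewrite expRN ler_pdivrMr ?expR_gt0// mulrAC.
have -> : x ^- n = x^-1 ^+ n.+2 * x ^+ 2.
  rewrite exprVn -addn2 exprD invfM -mulrA mulVf ?mulr1//.
  by rewrite expf_neq0// gt_eqF.
by rewrite ler_wpM2r// ?sqr_ge0// mulrC.
Qed.

Lemma is_derive_expinv n x :
  is_derive x 1 (expinv n) (- n%:R * expinv n.+1 x + expinv n.+2 x).
Proof.
have [x0|x0|->] := ltgtP x 0.
- apply: (@near_eq_is_derive _ _ _ (fun=> 0)).
    near=> y; rewrite /expinv ltNge; have -> // : y <= 0.
    by apply/ltW; near: y; exact: lt_nbhsl.
  rewrite /expinv ltNge (ltW x0)/= mulr0 addr0; exact: is_derive_cst.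
- apply: (@near_eq_is_derive _ _ _ (fun y : R => y ^- n * expR (- y^-1))).
    near=> y; rewrite /expinv; have -> // : 0 < y.
    by near: y; exact: lt_nbhsr.
  have xn0 : x != 0 by rewrite gt_eqF.
  have hinv : is_derive x 1 (fun y : R => y^-1) (- x ^- 2 *: (1 : R)).
    exact: is_deriveV.
  have hE : is_derive x 1 (fun y => expR (- y^-1)) (expR (- x^-1) * x ^- 2).
    have hN : is_derive x 1 (fun y : R => - y^-1) (x ^- 2).
      by apply: is_derive_eq; rewrite /GRing.scale/= mulr1 opprK.
    exact: (@is_derive1_comp R expR (fun y => - y^-1) x).
  rewrite /expinv x0; elim: n => [|n IH].
    under eq_fun do rewrite expr0 invr1 mul1r.
    by apply: is_derive_eq; rewrite oppr0 mul0r add0r mulrC.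
  under eq_fun do rewrite exprS invfM -mulrA.
  apply: is_derive_eq; rewrite /GRing.scale/= mulr1 -natr1.
  rewrite !exprS !invfM. by field; rewrite expf_neq0 xn0.
- rewrite {2 3}/expinv ltxx mulr0 addr0; apply: is_derive_quadratic => y.
  exact: expinv_quadratic.
Unshelve. all: by end_near. Qed.

Inductive expinv_span : (R -> R) -> Prop :=
| expinv_span_base n : expinv_span (expinv n)
| expinv_span_lin c f g of expinv_span f & expinv_span g :
    expinv_span (fun x => c * f x + g x).

Lemma smooth_expinv n : smooth (expinv n).
Proof.
apply: (@smooth_class _ expinv_span); last exact: expinv_span_base.
move=> f; elim=> {f} [m|c f g _ [df sf] _ [dg sg]]; split.
- by move=> x; apply: ex_derive; exact: is_derive_expinv.
- rewrite (_ : derive1 _ =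
      fun x => (- m%:R) * expinv m.+1 x + expinv m.+2 x).
    by apply: expinv_span_lin; exact: expinv_span_base.
  apply/funext => x; rewrite derive1E; apply: derive_val.
  exact: is_derive_expinv.
- by move=> x; apply: derivableD => //; exact: derivableZ.
- rewrite (_ : derive1 _ = fun x => c * derive1 f x + derive1 g x).
    exact: expinv_span_lin.
  apply/funext => x; rewrite !derive1E deriveD//; last exact: derivableZ.
  by rewrite deriveZ.
Qed.

Lemma expinv0_lt1 x : expinv 0 x < 1.
Proof.
rewrite /expinv; case: ifPn => x0 //; rewrite expr0 invr1 mul1r.
by rewrite expR_lt1 oppr_lt0 invr_gt0.
Qed.

Definition bump a b x : R := expinv 0 (x - a) * expinv 0 (b - x).

Lemma smooth_bump a b : smooth (bump a b).
Proof.
apply: smoothM.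
  rewrite (_ : (fun _ => _) = fun x => expinv 0 (1 * x + (- a))).
    exact/smooth_affine/smooth_expinv.
  by apply/funext => x; rewrite mul1r.
rewrite (_ : (fun _ => _) = fun x => expinv 0 (-1 * x + b)).
  exact/smooth_affine/smooth_expinv.
by apply/funext => x; rewrite mulN1r addrC.
Qed.

Lemma bump_ge0 a b x : 0 <= bump a b x.
Proof. by rewrite mulr_ge0// expinv_ge0. Qed.

Lemma bump_lt1 a b x : bump a b x < 1.
Proof.
by rewrite (le_lt_trans _ (expinv0_lt1 (b - x)))// ler_piMl ?expinv_ge0// ltW// expinv0_lt1.
Qed.

Lemma bump_gt0 a b x : a < x < b -> 0 < bump a b x.
Proof.
by move=> /andP[ax xb]; rewrite /bump /expinv !subr_gt0 ax xb !mulr_gt0 ?expR_gt0// expr0 invr1.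
Qed.

Lemma bump_eq0 a b x : ~~ (a < x < b) -> bump a b x = 0.
Proof.
rewrite negb_and /bump /expinv !subr_gt0 => /orP[] /negPf ->.
  by rewrite mul0r.
by rewrite mulr0.
Qed.

(** Smooth functions that increase with [n] to the indicator of the open interval from [a] to
[b], because [1 - bump] lies strictly between 0 and 1 on that interval and is 1 elsewhere. *)
Definition smooth_indic a b n x : R := 1 - (1 - bump a b x) ^+ n.

Lemma smooth_smooth_indic a b n : smooth (smooth_indic a b n).
Proof.
apply: smoothB; first exact: smooth_cst.
by apply: smoothX; apply: smoothB; [exact: smooth_cst|exact: smooth_bump].
Qed.

Lemma smooth_indic_bound a b n x : `|smooth_indic a b n x| <= 1.
Proof.
have h0 : 0 <= 1 - bump a b x by rewrite subr_ge0 ltW// bump_lt1.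
have h1 : 1 - bump a b x <= 1 by rewrite gerBl bump_ge0.
rewrite /smooth_indic ger0_norm ?gerBl ?exprn_ge0// subr_ge0.
exact: exprn_ile1.
Qed.

Lemma smooth_indic_out a b n x : ~~ (a < x < b) -> smooth_indic a b n x = 0.
Proof. by move=> h; rewrite /smooth_indic bump_eq0// subr0 expr1n subrr. Qed.

Lemma smooth_indic_cvg a b x :
  smooth_indic a b n x @[n --> \oo] --> (\1_(`]a, b[%classic : set R) x : R).
Proof.
rewrite indicE mem_setE in_itv/=; have [axb|axb] := boolP (a < x < b).
  rewrite -[X in _ --> X]subr0; apply: cvgB; first exact: cvg_cst.
  apply: cvg_expr; rewrite ger0_norm ?subr_ge0 ?ltW ?bump_lt1//.
  by rewrite gtrBl bump_gt0.
under eq_fun do rewrite smooth_indic_out//.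
exact: cvg_cst.
Qed.

End Bump.

(** * Integrable functions on an interval *)

Section Interval.
Context {R : realType}.
Variable (l : R).
Implicit Types (f g : R -> R) (a b c x : R).
Notation mu := (@lebesgue_measure R).
Notation I := (`]0, l[%classic : set R).
Notation "f =ae g" := (\forall x \ae mu, I x -> f x = g x) (at level 70).

Lemma ae_imp (P Q : R -> Prop) : (forall x, P x -> Q x) ->
  (\forall x \ae mu, P x) -> \forall x \ae mu, Q x.
Proof.
by move=> PQ; apply: filterS => //; exact: (ae_filter_ringOfSetsType mu).
Qed.

Lemma ae_and (P Q : R -> Prop) : (\forall x \ae mu, P x) ->
  (\forall x \ae mu, Q x) -> \forall x \ae mu, P x /\ Q x.
Proof.
by move=> HP HQ; apply: filterI => //; exact: (ae_filter_ringOfSetsType mu).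
Qed.

(** Measurability with respect to the Borel structure that carries the Lebesgue measure. *)
Definition meas f := measurable_fun (I : set (measurableTypeR R))
  (f : measurableTypeR R -> R).

Lemma continuous_meas f : continuous f -> meas f.
Proof. by move=> cf; apply: measurable_funTS; exact: continuous_measurable_fun. Qed.

Definition L1 f := mu.-integrable I (EFin \o f).

Lemma measurable_I : measurable (I : set (measurableTypeR R)).
Proof. exact: measurable_itv. Qed.

Lemma L1_measurable f : L1 f -> meas f.
Proof. by move=> /measurable_int /measurable_EFinP. Qed.

Lemma L1D f g : L1 f -> L1 g -> L1 (fun x => f x + g x).
Proof. exact: integrableD. Qed.

Lemma L1B f g : L1 f -> L1 g -> L1 (fun x => f x - g x).
Proof. exact: integrableB. Qed.

Lemma L1Z c f : L1 f -> L1 (fun x => c * f x).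
Proof. exact: integrableZl. Qed.

Lemma intD f g : L1 f -> L1 g ->
  \int[mu]_(x in I) (f x + g x) = \int[mu]_(x in I) f x + \int[mu]_(x in I) g x.
Proof. by move=> Lf Lg; rewrite RintegralD. Qed.

Lemma intB f g : L1 f -> L1 g ->
  \int[mu]_(x in I) (f x - g x) = \int[mu]_(x in I) f x - \int[mu]_(x in I) g x.
Proof. by move=> Lf Lg; rewrite RintegralB. Qed.

Lemma intZ c f : L1 f ->
  \int[mu]_(x in I) (c * f x) = c * \int[mu]_(x in I) f x.
Proof. by move=> Lf; rewrite RintegralZl. Qed.

Lemma continuous_bounded g : continuous g -> [bounded g x | x in I].
Proof.
move=> cg; have /compact_bounded [M [Mr HM]] : compact (g @` `[0, l]%classic).
  apply: continuous_compact; last exact: segment_compact.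
  exact: continuous_subspaceT.
exists M; split=> // y My x /= xI; apply: HM => //; exists x => //.
by apply: subset_itv_oo_cc xI.
Qed.

Lemma L1_continuousM f g : L1 f -> continuous g -> L1 (fun x => f x * g x).
Proof.
move=> Lf cg; have mg := continuous_meas cg.
exact: (integrableMl measurable_I Lf mg (continuous_bounded cg)).
Qed.

Lemma L1_cst c : L1 (fun=> c).
Proof.
apply: measurable_bounded_integrable => //.
  by rewrite /= lebesgue_measure_itv/=; case: ifP => // _; rewrite -EFinB ltry.
exists `|c|; split=> // y cy x _; exact/ltW.
Qed.

Lemma L1_continuous g : continuous g -> L1 g.
Proof.
move=> cg; have := @L1_continuousM (fun=> 1) g (L1_cst 1) cg.
by congr L1; apply/funext => x; rewrite mul1r.
Qed.

(** [|f| <= 1 + f ^+ 2] and the interval has finite length. *)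
Lemma L2_L1 f : L2 l f -> L1 f.
Proof.
move=> [mf f2].
apply: (@le_integrable _ _ _ mu I measurable_I _ (fun x => (1 + f x ^+ 2)%:E)).
- exact/measurable_EFinP.
- move=> x _; rewrite /= lee_fin [leRHS]ger0_norm ?addr_ge0 ?sqr_ge0//.
  rewrite -(real_normK (num_real (f x))).
  have := sqr_ge0 (`|f x| - 1); have := normr_ge0 (f x); nra.
- apply: (@L1D (fun=> 1) (fun x => f x ^+ 2)) f2; exact: L1_cst.
Qed.

Lemma L2_continuous g : continuous g -> L2 l g.
Proof.
move=> cg; split.
  by apply: measurable_funTS; exact: continuous_measurable_fun.
apply: (@L1_continuous (fun x => g x ^+ 2)) => x.
by apply: (@continuousM _ _ (g) g x); exact: cg.
Qed.

Lemma ae_eq_int f g : meas f -> meas g -> f =ae g ->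
  \int[mu]_(x in I) f x = \int[mu]_(x in I) g x.
Proof.
move=> mf mg fg; congr fine; apply: ae_eq_integral => //.
- exact/measurable_EFinP.
- exact/measurable_EFinP.
- by apply: ae_imp fg => x /[apply] ->.
Qed.

Lemma test_smooth phi : test_function l phi -> smooth phi.
Proof. by move=> []. Qed.

Lemma test_indic a b n : 0 < a -> b < l -> test_function l (smooth_indic a b n).
Proof.
move=> a0 bl; split; first exact: smooth_smooth_indic.
exists a, b; split=> // x; rewrite in_itv/= => xab.
by apply: smooth_indic_out; apply: contra xab => /andP[/ltW -> /ltW ->].
Qed.

(** By dominated convergence from test functions to the indicator of the interval. *)
Lemma integral_itv_eq0 g : L1 g ->
  (forall phi, test_function l phi -> \int[mu]_(x in I) (g x * phi x) = 0) ->
  forall a b, 0 < a -> b < l -> \int[mu]_(x in `]a, b[) g x = 0.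
Proof.
move=> Lg gphi a b a0 bl.
have subI : `]a, b[%classic `<=` I.
  move=> x /=; rewrite !in_itv/= => /andP[ax xb].
  by rewrite (lt_trans a0 ax) (lt_trans xb bl).
rewrite -(setIidr subI) Rintegral_mkcondr.
rewrite (@eq_Rintegral _ _ _ mu I (fun x => g x * \1_(`]a, b[%classic) x)); last first.
  move=> x _; rewrite patchE indicE; case: ifPn => _; rewrite ?mulr1 ?mulr0//.
have Ln n : L1 (fun x => g x * smooth_indic a b n x).
  by apply: L1_continuousM => //; apply/smooth_continuous/smooth_smooth_indic.
have H : (\int[mu]_(x in I) (g x * smooth_indic a b n x)%:E)%E @[n --> \oo]
    --> (\int[mu]_(x in I) (g x * \1_(`]a, b[%classic) x)%:E)%E.
  apply: (@dominated_cvg _ _ _ mu I measurable_I _ _ (fun x => (`|g x|)%:E)).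
  - by move=> n; have /measurable_int := Ln n.
  - move=> x _; apply: cvg_EFin; first by near=> n.
    by apply: cvgM; [exact: cvg_cst|exact: smooth_indic_cvg].
  - by [].
  - by have := integrable_norm Lg.
  - move=> n x _ /=; rewrite lee_fin normrM ler_piMr//.
    exact: smooth_indic_bound.
have E n : (\int[mu]_(x in I) (g x * smooth_indic a b n x)%:E = 0)%E.
  rewrite -[LHS]fineK; last exact: integrable_fin_num (Ln n).
  congr EFin; apply: gphi; exact: test_indic.
have : (\int[mu]_(x in I) (g x * \1_(`]a, b[%classic) x)%:E = 0)%E.
  apply/esym; move: H => /cvg_lim <-//.
  by under eq_fun do rewrite E; rewrite lim_cst.
by rewrite /Rintegral => ->.
Unshelve. all: by end_near. Qed.

End Interval.

(** * The fundamental lemma of the calculus of variations *)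

Section FLCV.
Context {R : realType}.
Variable (l : R).
Implicit Types (f g : R -> R) (a b c x : R).
Notation mu := (@lebesgue_measure R).
Notation I := (`]0, l[%classic : set R).
Notation "f =ae g" := (\forall x \ae mu, I x -> f x = g x) (at level 70).

(** A nonempty open interval is not negligible. *)
Lemma ae_exists (P : R -> Prop) a b : (\forall x \ae mu, I x -> P x) ->
  0 <= a -> a < b -> b <= l -> exists2 x, a < x < b & P x.
Proof.
move=> [N [mN N0 subN]] a0 ab bl; apply: contrapT => nP.
have sub : `]a, b[%classic `<=` N.
  move=> x /=; rewrite in_itv/= => xab; apply: subN => /= Px; apply: nP.
  exists x => //; apply: Px; rewrite in_itv/=.
  by case/andP: xab => ax xb; rewrite (le_lt_trans a0 ax) (lt_le_trans xb bl).
have : (mu `]a, b[%classic <= 0)%E.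
  by rewrite -N0; apply: le_measure => //; rewrite inE //; exact: measurable_itv.
by rewrite lebesgue_measure_itv/= lte_fin ab -EFinB lee_fin leNgt subr_gt0 ab.
Qed.

Lemma integrable_ext g : L1 l g -> (forall x, ~ I x -> g x = 0) ->
  mu.-integrable setT (EFin \o g).
Proof.
move=> Lg g0.
have := (@integrable_mkcond _ _ _ mu I (EFin \o g) (measurable_I l)).1 Lg.
apply: eq_integrable => // x _.
rewrite /= patchE; case: ifPn => // /negP xI; rewrite g0//.
by move=> h; apply: xI; rewrite inE.
Qed.

(** The indefinite integral of [g] is constant between 0 and [l], and by Lebesgue's
differentiation theorem its derivative is [g] almost everywhere. *)
Lemma fundamental_lemma g : L1 l g ->
  (forall phi, test_function l phi -> \int[mu]_(x in I) (g x * phi x) = 0) ->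
  g =ae (fun=> 0).
Proof.
move=> Lg gphi; have itv0 := integral_itv_eq0 Lg gphi.
pose G := g \_ I.
have iG : mu.-integrable setT (EFin \o G).
  have := (@integrable_mkcond _ _ _ mu I (EFin \o g) (measurable_I l)).1 Lg.
  by apply: eq_integrable => // x _; rewrite /G /= !patchE; case: ifP.
have iGy y : mu.-integrable `]-oo, y] (EFin \o G).
  by apply: integrableS iG => //; exact: measurable_itv.
have lG : locally_integrable setT G by exact: integrable_locally_restrict.
have := FTC1Ny iGy lG; apply: ae_imp => x [dF F'] xI.
have : G x = g x by rewrite /G patchE mem_set.
rewrite -F' => <-.
set F := (fun x => _).
have Fc a b : 0 < a -> a <= b -> b < l -> F a = F b.
  move=> a0 ab bl; apply/esym/eqP; rewrite -subr_eq0; apply/eqP.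
  rewrite /F Rintegral_itvB//.
  rewrite -Rintegral_itv_bndo_bndc; last exact: integrableS (iG).
  rewrite -[RHS](itv0 a b)//; apply: eq_Rintegral => y.
  rewrite inE/= in_itv/= => /andP[ay yb].
  by rewrite /G patchE mem_set//= in_itv/= (lt_trans a0 ay) (lt_trans yb bl).
move: xI; rewrite /= in_itv/= => /andP[x0 xl].
rewrite derive1E (@near_eq_derive _ _ _ _ (fun=> F x))//.
  by rewrite derive_cst.
near=> y; have y0 : 0 < y by near: y; exact: lt_nbhsr.
have yl : y < l by near: y; exact: lt_nbhsl.
by case: (leP x y) => [xy|/ltW yx]; [apply/esym/Fc|apply/Fc].
Unshelve. all: by end_near. Qed.

End FLCV.

(** * The du Bois-Reymond lemma and weak derivatives *)

Section DBR.
Context {R : realType}.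
Variable (l : R).
Implicit Types (f g phi : R -> R) (a b x : R).
Notation mu := (@lebesgue_measure R).
Notation I := (`]0, l[%classic : set R).
Notation "f =ae g" := (\forall x \ae mu, I x -> f x = g x) (at level 70).

Lemma test_mul phi c : smooth c -> test_function l phi ->
  test_function l (fun x => c x * phi x).
Proof.
move=> sc [sphi [a [b [a0 bl phi0]]]]; split; first exact: smoothM.
by exists a, b; split=> // x /phi0 ->; rewrite mulr0.
Qed.

Lemma test_add phi psi : test_function l phi -> test_function l psi ->
  test_function l (fun x => phi x + psi x).
Proof.
move=> [sphi [a [b [a0 bl phi0]]]] [spsi [a' [b' [a0' bl' psi0]]]].
split; first exact: smoothD.
exists (Num.min a a'), (Num.max b b'); split.
- by rewrite lt_min a0.
- by rewrite gt_max bl.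
- move=> x; rewrite in_itv/= ge_min le_max => nx.
  rewrite phi0 ?psi0 ?addr0// in_itv/=; apply: contra nx => /andP[-> ->];
  by rewrite ?orbT.
Qed.

Lemma test_L1M f phi : L1 l f -> test_function l phi ->
  L1 l (fun x => f x * phi x).
Proof. by move=> Lf /test_smooth/smooth_continuous; exact: L1_continuousM. Qed.

Lemma test_L1M' f phi : L1 l f -> test_function l phi ->
  L1 l (fun x => f x * derive1 phi x).
Proof.
move=> Lf /test_smooth/smooth_derive1/smooth_continuous.
exact: L1_continuousM.
Qed.

Lemma test_L1 phi : test_function l phi -> L1 l phi.
Proof. by move=> /test_smooth/smooth_continuous/L1_continuous. Qed.

(** The integral from minus infinity vanishes to the right of the support precisely because
the total integral is zero. *)
Lemma test_antiderivative psi : test_function l psi ->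
  \int[mu]_(x in I) psi x = 0 ->
  exists2 phi, test_function l phi & derive1 phi = psi.
Proof.
move=> tpsi int0; have [spsi [a [b [a0 bl psi0]]]] := tpsi.
have ipsi : mu.-integrable setT (EFin \o psi).
  apply: (@integrable_ext _ l); first exact: test_L1.
  move=> x /negP xI; apply: psi0; apply: contra xI.
  rewrite !in_itv/= => /andP[ax xb].
  by rewrite (lt_le_trans a0 ax) (le_lt_trans xb bl).
pose F x := \int[mu]_(t in `]-oo, x]) psi t.
have dF x : is_derive x 1 F (psi x).
  have [dF <-] : derivable F x 1 /\ derive1 F x = psi x.
    apply: (@continuous_FTC1 R psi -oo%O x (x + 1)).
    - by rewrite ltrDl.
    - by apply: integrableS ipsi => //; exact: measurable_itv.
    - by rewrite ltNyr.
    - exact: smooth_continuous.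
  by rewrite derive1E; exact: DeriveDef.
have F' : derive1 F = psi.
  by apply/funext => x; rewrite derive1E; exact: derive_val.
have sF : smooth F.
  move=> [|n] x; first exact: ex_derive.
  by rewrite /derive1n iterSr F'; exact: spsi.
exists F => //; split=> //; exists a, b; split=> // x.
rewrite in_itv/= negb_and -!ltNge => /orP[xa|bx].
  rewrite /F (@eq_Rintegral _ _ _ mu _ (fun=> 0)) ?Rintegral_cst ?mul0r//.
  move=> t; rewrite inE/= in_itv/= => tx; apply: psi0.
  by rewrite in_itv/= leNgt (le_lt_trans tx xa).
rewrite -int0 /F Rintegral_mkcond [RHS]Rintegral_mkcond.
apply: eq_Rintegral => t _; rewrite !patchE.
case: ifPn; case: ifPn => //; rewrite !notin_setE !inE/= !in_itv/=.
  move=> tI _; apply: psi0; apply: contra_notN tI.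
  rewrite in_itv/= => /andP[ax xb].
  by rewrite (lt_le_trans a0 ax) (le_lt_trans xb bl).
move=> _ /negP; rewrite -ltNge => xt; apply/esym/psi0.
by rewrite in_itv/= negb_and -!ltNge (lt_trans bx xt) orbT.
Qed.

(** Otherwise the constant 1 would vanish almost everywhere by the fundamental lemma. *)
Lemma test_exists : 0 < l ->
  exists2 eta, test_function l eta & \int[mu]_(x in I) eta x != 0.
Proof.
move=> l0; apply: contrapT => H.
have : (fun=> (1 : R)) =ae (fun=> (0 : R)).
  apply: fundamental_lemma; first exact: L1_cst.
  move=> phi tphi; apply: contrapT => /eqP n0; apply: H.
  by move: n0; under eq_Rintegral do rewrite mul1r; exists phi.
move=> /(@ae_exists _ l _ 0 l) /(_ (lexx 0) l0 (lexx l)) [x _ /eqP].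
by rewrite oner_eq0.
Qed.

(** Subtracting from a test function its multiple of a fixed [eta] with nonzero integral
leaves the derivative of a test function. So [f] minus a suitable constant is orthogonal to
every test function. *)
Lemma du_Bois_Reymond f : 0 < l -> L1 l f ->
  (forall phi, test_function l phi -> \int[mu]_(x in I) (f x * derive1 phi x) = 0) ->
  exists c, f =ae (fun=> c).
Proof.
move=> l0 Lf fphi; have [eta teta eta0] := test_exists l0.
set m := \int[mu]_(x in I) eta x in eta0.
pose c := (\int[mu]_(x in I) (f x * eta x)) / m.
exists c.
have : (fun x => f x - c) =ae (fun=> 0).
  apply: fundamental_lemma => [|phi tphi].
    by apply: L1B => //; exact: L1_cst.
  pose k := (\int[mu]_(x in I) phi x) / m.
  have teta' : test_function l (fun x => - k * eta x).
    apply: (@test_mul eta (fun=> - k)) => //; exact: smooth_cst.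
  have tpsi := test_add tphi teta'.
  case: (test_antiderivative tpsi).
    rewrite intD ?intZ; try exact: test_L1.
    by rewrite mulNr /k divfK// subrr.
  move=> Phi tPhi Phi'; have := fphi _ tPhi; rewrite Phi'.
  rewrite (@eq_Rintegral _ _ _ mu I (fun x => f x * phi x + (- k) * (f x * eta x))).
    rewrite intD ?intZ; try by [exact: test_L1M | apply: L1Z; exact: test_L1M].
    move=> H.
    rewrite (@eq_Rintegral _ _ _ mu I (fun x => f x * phi x + (- c) * phi x)).
      rewrite intD ?intZ; try by [exact: test_L1|exact: test_L1M|
        apply: L1Z; exact: test_L1].
      rewrite -[RHS]H; congr (_ + _); rewrite /k /c; ring.
    by move=> x _; ring.
  by move=> x _; ring.
by apply: ae_imp => x /[apply] /eqP; rewrite subr_eq0 => /eqP.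
Qed.

Lemma weak_unique f g1 g2 : L1 l g1 -> L1 l g2 ->
  is_weak_derivative l f g1 -> is_weak_derivative l f g2 -> g1 =ae g2.
Proof.
move=> L1g L2g w1 w2.
have : (fun x => g1 x - g2 x) =ae (fun=> 0).
  apply: fundamental_lemma => [|phi tphi]; first exact: L1B.
  under eq_Rintegral do rewrite mulrBl.
  rewrite intB; try exact: test_L1M.
  by apply/eqP; rewrite subr_eq0 -eqr_opp -(w1 _ tphi) (w2 _ tphi).
by apply: ae_imp => x /[apply] /eqP; rewrite subr_eq0 => /eqP.
Qed.

Lemma weak_ae f1 f2 g1 g2 : L1 l f1 -> L1 l f2 -> L1 l g1 -> L1 l g2 ->
  f1 =ae f2 -> g1 =ae g2 ->
  is_weak_derivative l f1 g1 -> is_weak_derivative l f2 g2.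
Proof.
move=> L1f L2f L1g L2g f12 g12 w phi tphi.
have -> : \int[mu]_(x in I) (f2 x * derive1 phi x) =
          \int[mu]_(x in I) (f1 x * derive1 phi x).
  apply: ae_eq_int.
  - by apply: L1_measurable; exact: test_L1M'.
  - by apply: L1_measurable; exact: test_L1M'.
  - by apply: ae_imp f12 => x /[apply] ->.
have -> : \int[mu]_(x in I) (g2 x * phi x) = \int[mu]_(x in I) (g1 x * phi x).
  apply: ae_eq_int.
  - by apply: L1_measurable; exact: test_L1M.
  - by apply: L1_measurable; exact: test_L1M.
  - by apply: ae_imp g12 => x /[apply] ->.
exact: w.
Qed.

Lemma weakD f1 f2 g1 g2 : L1 l f1 -> L1 l f2 -> L1 l g1 -> L1 l g2 ->
  is_weak_derivative l f1 g1 -> is_weak_derivative l f2 g2 ->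
  is_weak_derivative l (fun x => f1 x + f2 x) (fun x => g1 x + g2 x).
Proof.
move=> L1f L2f L1g L2g w1 w2 phi tphi.
under eq_Rintegral do rewrite mulrDl.
rewrite intD; try exact: test_L1M'.
under [in RHS]eq_Rintegral do rewrite mulrDl.
rewrite intD; try exact: test_L1M.
by rewrite w1// w2// opprD.
Qed.

(** If [phi] is a test function then so is [c phi]; apply the definition to it. *)
Lemma weakM f g c : L1 l f -> L1 l g -> smooth c -> is_weak_derivative l f g ->
  is_weak_derivative l (fun x => f x * c x)
    (fun x => g x * c x + f x * derive1 c x).
Proof.
move=> Lf Lg sc w phi tphi.
have tcphi := test_mul sc tphi.
have tc'phi := test_mul (smooth_derive1 sc) tphi.
have cphi' : derive1 (fun x => c x * phi x) =
    fun x => c x * derive1 phi x + phi x * derive1 c x.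
  apply/funext => x; rewrite !derive1E.
  by apply: deriveM; apply: smooth_derivable => //; exact: test_smooth tphi.
rewrite (@eq_Rintegral _ _ _ mu I (fun x => f x * derive1 (fun x => c x * phi x) x
   - f x * (derive1 c x * phi x))); last first.
  by move=> x _; rewrite cphi'; ring.
rewrite intB; [|exact: test_L1M'|exact: test_L1M].
rewrite w// -opprD; congr (- _).
rewrite -intD; [|exact: test_L1M|exact: test_L1M].
by apply: eq_Rintegral => x _; ring.
Qed.

Lemma weakZ f g c : L1 l f -> L1 l g -> is_weak_derivative l f g ->
  is_weak_derivative l (fun x => c * f x) (fun x => c * g x).
Proof.
move=> Lf Lg w phi tphi.
under eq_Rintegral do rewrite -mulrA.
rewrite intZ; last exact: test_L1M'.
under [in RHS]eq_Rintegral do rewrite -mulrA.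
rewrite intZ; last exact: test_L1M.
by rewrite w// mulrN.
Qed.

Lemma weak_smooth f : 0 < l -> smooth f -> is_weak_derivative l f (derive1 f).
Proof.
move=> l0 sf phi tphi; have [sphi [a [b [a0 bl phi0]]]] := tphi.
(* The formula for integration by parts is on the closed interval. *)
have toc (h : R -> R) : continuous h ->
    \int[mu]_(x in I) h x = \int[mu]_(x in `[0, l]) h x.
  move=> ch.
  have ih : mu.-integrable (`[0, l]%classic : set R) (EFin \o h).
    apply: continuous_compact_integrable; first exact: segment_compact.
    exact: continuous_subspaceT.
  rewrite -Rintegral_itv_obnd_cbnd; last first.
    by apply: integrableS ih => //=; [exact: measurable_itv..|exact: subset_itv_oc_cc].
  rewrite -Rintegral_itv_bndo_bndc//.
  by apply: integrableS ih => //=; [exact: measurable_itv..|exact: subset_itv_oo_cc].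
have csf := smooth_continuous sf; have csphi := smooth_continuous sphi.
have cdf := smooth_continuous (smooth_derive1 sf).
have cdphi := smooth_continuous (smooth_derive1 sphi).
rewrite !toc; try by move=> x; apply: continuousM; [exact: csf || exact: cdf|
  exact: csphi || exact: cdphi].
have LR (h : R -> R) : smooth h -> derivable_oo_LRcontinuous h 0 l.
  move=> sh; split.
  - by move=> x _; exact: smooth_derivable.
  - by apply: cvg_at_right_filter; exact: smooth_continuous.
  - by apply: cvg_at_left_filter; exact: smooth_continuous.
rewrite (@Rintegration_by_parts _ f phi (derive1 f) (derive1 phi))//; last 4 first.
- exact: continuous_subspaceT.
- exact: LR.
- exact: continuous_subspaceT.
- exact: LR.
rewrite !phi0 ?mulr0 ?subr0 ?sub0r// in_itv/= negb_and -!ltNge.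
  by rewrite a0.
by rewrite bl orbT.
Qed.

End DBR.

(** * Solutions of - f'' = mu f *)

Section FundamentalPair.
Context {R : realType}.
Implicit Types (mu nu x y L : R).

Definition coshk (k x : R) : R := 2^-1 * (expR (k * x) + expR (- (k * x))).
Definition sinhk (k x : R) : R := (2 * k)^-1 * (expR (k * x) - expR (- (k * x))).

(** [cosl mu] and [sinl mu] are the solutions of [- f'' = mu f] with initial data (1, 0) and
(0, 1) at 0. They are entire in mu: trigonometric, affine or hyperbolic according to its sign. *)
Definition cosl mu x : R :=
  if 0 <= mu then cos (Num.sqrt mu * x) else coshk (Num.sqrt (- mu)) x.

Definition sinl mu x : R :=
  if 0 < mu then sin (Num.sqrt mu * x) / Num.sqrt mu
  else if mu == 0 then x else sinhk (Num.sqrt (- mu)) x.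

Lemma is_derive_scale (f : R -> R) a x d : is_derive (a * x) 1 f d ->
  is_derive x 1 (fun y => f (a * y)) (a * d).
Proof.
move=> fd; have -> : (fun y => f (a * y)) = (fun y => f (a * y + 0)).
  by apply/funext => y; rewrite addr0.
by apply: is_derive_affine; rewrite addr0.
Qed.

Lemma is_derive_cosl mu x : is_derive x 1 (cosl mu) (- mu * sinl mu x).
Proof.
rewrite /cosl /sinl; case: (ltgtP mu 0) => [m0|m0|->].
- have k0 : 0 < Num.sqrt (- mu) by rewrite sqrtr_gt0 oppr_gt0.
  have kk : - mu = Num.sqrt (- mu) ^+ 2 by rewrite sqr_sqrtr// oppr_ge0 ltW.
  move: (Num.sqrt _) k0 kk => k k0 ->; rewrite /coshk /sinhk.
  have h1 : is_derive x 1 (fun y => expR (k * y)) (k * expR (k * x)).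
    exact: is_derive_scale.
  have h2 : is_derive x 1 (fun y => expR (- (k * y))) (- k * expR (- (k * x))).
    rewrite -mulNr; under eq_fun do rewrite -mulNr; exact: is_derive_scale.
  apply: is_derive_eq; rewrite /GRing.scale/=; field.
  by rewrite gt_eqF.
- have k0 : 0 < Num.sqrt mu by rewrite sqrtr_gt0.
  have kk : mu = Num.sqrt mu ^+ 2 by rewrite sqr_sqrtr// ltW.
  have -> : - mu * (sin (Num.sqrt mu * x) / Num.sqrt mu) =
     Num.sqrt mu * (- sin (Num.sqrt mu * x)).
    rewrite {1}kk; field; by rewrite gt_eqF.
  exact: is_derive_scale.
- rewrite oppr0 mul0r sqrtr0 [X in is_derive _ _ X](_ : _ = fun=> cos 0).
    exact: is_derive_cst.
  by apply/funext => y; rewrite mul0r.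
Qed.

Lemma is_derive_sinl mu x : is_derive x 1 (sinl mu) (cosl mu x).
Proof.
rewrite /cosl /sinl; case: (ltgtP mu 0) => [m0|m0|->].
- have k0 : 0 < Num.sqrt (- mu) by rewrite sqrtr_gt0 oppr_gt0.
  move: (Num.sqrt _) k0 => k k0; rewrite /coshk /sinhk.
  have h1 : is_derive x 1 (fun y => expR (k * y)) (k * expR (k * x)).
    exact: is_derive_scale.
  have h2 : is_derive x 1 (fun y => expR (- (k * y))) (- k * expR (- (k * x))).
    rewrite -mulNr; under eq_fun do rewrite -mulNr; exact: is_derive_scale.
  apply: is_derive_eq; rewrite /GRing.scale/=; field.
  by rewrite gt_eqF.
- have k0 : 0 < Num.sqrt mu by rewrite sqrtr_gt0.
  have -> : (fun x => sin (Num.sqrt mu * x) / Num.sqrt mu) =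
            (fun x => (Num.sqrt mu)^-1 * sin (Num.sqrt mu * x)).
    by apply/funext => y; rewrite mulrC.
  have h1 := is_derive_scale (is_derive_sin (Num.sqrt mu * x)).
  apply: is_derive_eq; rewrite /GRing.scale/= mulrA mulVf ?mul1r//.
  by rewrite gt_eqF.
- rewrite sqrtr0 mul0r cos0; exact: is_derive_id.
Qed.

Lemma cosl0 mu : cosl mu 0 = 1.
Proof.
by rewrite /cosl /coshk !mulr0 cos0 oppr0 expR0; case: ifP => // _; field.
Qed.

Lemma sinl0 mu : sinl mu 0 = 0.
Proof.
by rewrite /sinl /sinhk !mulr0 sin0 oppr0 expR0 subrr mulr0 mul0r !if_same.
Qed.

Lemma coslN mu x : cosl mu (- x) = cosl mu x.
Proof.
by rewrite /cosl /coshk !mulrN cosN opprK [X in 2^-1 * X]addrC.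
Qed.

Lemma sinlN mu x : sinl mu (- x) = - sinl mu x.
Proof.
rewrite /sinl /sinhk !mulrN sinN opprK; case: ifP => [_|_]; first by rewrite mulNr.
by case: ifP => // _; ring.
Qed.

Lemma coslD mu x y :
  cosl mu (x + y) = cosl mu x * cosl mu y - mu * (sinl mu x * sinl mu y).
Proof.
rewrite /cosl /sinl; case: (ltgtP mu 0) => [m0|m0|->].
- have k0 : 0 < Num.sqrt (- mu) by rewrite sqrtr_gt0 oppr_gt0.
  have kk : mu = - Num.sqrt (- mu) ^+ 2.
    by rewrite sqr_sqrtr ?opprK// oppr_ge0 ltW.
  move: (Num.sqrt _) k0 kk => k k0 ->; rewrite /coshk /sinhk.
  rewrite [k * (x + y)]mulrDr opprD !expRD; field; by rewrite gt_eqF.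
- have k0 : 0 < Num.sqrt mu by rewrite sqrtr_gt0.
  have kk : mu = Num.sqrt mu ^+ 2 by rewrite sqr_sqrtr// ltW.
  move: (Num.sqrt mu) k0 kk => k k0 ->.
  rewrite [k * (x + y)]mulrDr cosD; field; by rewrite gt_eqF.
- by rewrite sqrtr0 !mul0r cos0 mulr1 subr0.
Qed.

Lemma sinlD mu x y :
  sinl mu (x + y) = sinl mu x * cosl mu y + cosl mu x * sinl mu y.
Proof.
rewrite /cosl /sinl; case: (ltgtP mu 0) => [m0|m0|->].
- have k0 : 0 < Num.sqrt (- mu) by rewrite sqrtr_gt0 oppr_gt0.
  move: (Num.sqrt _) k0 => k k0; rewrite /coshk /sinhk.
  rewrite [k * (x + y)]mulrDr opprD !expRD; field; by rewrite gt_eqF.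
- have k0 : 0 < Num.sqrt mu by rewrite sqrtr_gt0.
  by rewrite [Num.sqrt mu * (x + y)]mulrDr sinD; field; rewrite gt_eqF.
- by rewrite sqrtr0 !mul0r cos0 mulr1 mul1r.
Qed.

(** This is the Wronskian of the fundamental solutions. *)
Lemma pythagoras mu x : cosl mu x ^+ 2 + mu * sinl mu x ^+ 2 = 1.
Proof.
have := coslD mu x (- x); rewrite subrr cosl0 coslN sinlN => ->; ring.
Qed.

Lemma derive1_cosl mu : derive1 (cosl mu) = fun x => - mu * sinl mu x.
Proof.
apply/funext => x; rewrite derive1E; apply: derive_val; exact: is_derive_cosl.
Qed.

Lemma derive1_sinl mu : derive1 (sinl mu) = cosl mu.
Proof.
apply/funext => x; rewrite derive1E; apply: derive_val; exact: is_derive_sinl.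
Qed.

(** The solution with value [A] and derivative [B] at 0. Its derivative is the solution with
data [B] and [- mu * A]. *)
Definition sol mu (A B x : R) := A * cosl mu x + B * sinl mu x.

Lemma is_derive_sol mu A B x :
  is_derive x 1 (sol mu A B) (sol mu B (- mu * A) x).
Proof.
have h1 := is_derive_cosl mu x; have h2 := is_derive_sinl mu x.
have h3 := is_deriveZ A h1; have h4 := is_deriveZ B h2.
by apply: is_derive_eq; rewrite /GRing.scale/= /sol; ring.
Qed.

Lemma derive1_sol mu A B : derive1 (sol mu A B) = sol mu B (- mu * A).
Proof.
apply/funext => x; rewrite derive1E; apply: derive_val; exact: is_derive_sol.
Qed.

Lemma smooth_sol mu A B : smooth (sol mu A B).
Proof.
apply: (@smooth_class _ (fun f => exists A B, f = sol mu A B)); last by exists A, B.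
move=> _ [a [b ->]]; split=> [x|]; first exact: (@ex_derive _ _ _ _ _ _ _ (is_derive_sol _ _ _ _)).
by exists b, (- mu * a); rewrite derive1_sol.
Qed.

Lemma sol_cos mu : sol mu 1 0 = cosl mu.
Proof. by apply/funext => x; rewrite /sol mul1r mul0r addr0. Qed.

Lemma sol_sin mu : sol mu 0 1 = sinl mu.
Proof. by apply/funext => x; rewrite /sol mul0r mul1r add0r. Qed.

Lemma smooth_cosl mu : smooth (cosl mu).
Proof. by rewrite -sol_cos; exact: smooth_sol. Qed.

Lemma smooth_sinl mu : smooth (sinl mu).
Proof. by rewrite -sol_sin; exact: smooth_sol. Qed.

(** For negative mu the square root is 0, so the condition holds and the hyperbolic
sine is positive for all positive [x]. *)
Lemma sinl_gt0 mu x : 0 < x -> Num.sqrt mu * x < pi -> 0 < sinl mu x.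
Proof.
move=> x0 h; rewrite /sinl; case: (ltgtP mu 0) => [m0|m0|//].
- have k0 : 0 < Num.sqrt (- mu) by rewrite sqrtr_gt0 oppr_gt0.
  rewrite /sinhk mulr_gt0 ?invr_gt0 ?mulr_gt0// subr_gt0 ltr_expR.
  by rewrite (@lt_trans _ _ 0) ?oppr_lt0 ?mulr_gt0.
- by rewrite divr_gt0 ?sqrtr_gt0// sin_gt0_pi// mulr_gt0 ?sqrtr_gt0.
Qed.

Lemma cosl_gt0 mu x : 0 <= x -> Num.sqrt mu * x < pi / 2 -> 0 < cosl mu x.
Proof.
move=> x0 h; rewrite /cosl; case: ifP => [m0|_]; last first.
  by rewrite /coshk mulr_gt0 ?invr_gt0// addr_gt0// expR_gt0.
rewrite cos_gt0_pihalf// h andbT (@lt_le_trans _ _ 0) ?mulr_ge0 ?sqrtr_ge0//.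
by rewrite oppr_lt0 divr_gt0 ?pi_gt0.
Qed.

Lemma cosl_le0 mu x : 0 <= mu -> pi / 2 <= Num.sqrt mu * x <= pi -> cosl mu x <= 0.
Proof.
move=> m0 /andP[h1 h2]; rewrite /cosl m0.
rewrite -[Num.sqrt mu * x](subrK (pi / 2)) cosDpihalf oppr_le0.
rewrite sin_ge0_pi// subr_ge0 h1/=.
by rewrite lerBlDr (le_trans h2)// lerDl divr_ge0 ?pi_ge0.
Qed.

Lemma pos_from_derive (f g : R -> R) L : 0 < L -> f 0 = 0 ->
  (forall x, is_derive x 1 f (g x)) -> (forall x, 0 < x < L -> 0 < g x) -> 0 < f L.
Proof.
move=> L0 f0 df g0.
have [|x /g0 gx] := @MVT R f g 0 L L0 (fun x _ => df x).
  apply: continuous_subspaceT => x; apply: differentiable_continuous.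
  by apply/derivable1_diffP; exact: (@ex_derive _ _ _ _ _ _ _ (df x)).
by rewrite f0 !subr0 => ->; rewrite mulr_gt0.
Qed.

Lemma sqrt_mul_lt mu nu x p : mu <= nu -> 0 <= x -> Num.sqrt nu * x < p -> Num.sqrt mu * x < p.
Proof.
by move=> mn x0; apply: le_lt_trans; rewrite ler_wpM2r// ler_wsqrtr.
Qed.

(** Sturm comparison: the derivative in [x] of the numerator of the difference,
the Wronskian of [sinl mu] and [sinl nu], is [(nu - mu) * (sinl mu x * sinl nu x)]. *)
Lemma cot_decr mu nu h : mu < nu -> 0 < h -> Num.sqrt nu * h < pi ->
  cosl nu h / sinl nu h < cosl mu h / sinl mu h.
Proof.
move=> mn h0 hp; have hm := sqrt_mul_lt (ltW mn) (ltW h0) hp.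
have sn := sinl_gt0 h0 hp; have sm := sinl_gt0 h0 hm.
rewrite ltr_pdivrMr// mulrAC ltr_pdivlMr// -subr_gt0.
apply: (@pos_from_derive (fun x => cosl mu x * sinl nu x - cosl nu x * sinl mu x)
  (fun x => (nu - mu) * (sinl mu x * sinl nu x))) => //.
- by rewrite !sinl0 !mulr0 subrr.
- move=> x; have h1 := is_derive_cosl mu x; have h2 := is_derive_sinl mu x.
  have h3 := is_derive_cosl nu x; have h4 := is_derive_sinl nu x.
  apply: is_derive_eq; rewrite /GRing.scale/=; ring.
- move=> x /andP[x0 xh]; rewrite mulr_gt0 ?subr_gt0// mulr_gt0// sinl_gt0//.
    by apply: le_lt_trans hm; rewrite ler_wpM2l ?sqrtr_ge0 ?ltW.
  by apply: le_lt_trans hp; rewrite ler_wpM2l ?sqrtr_ge0 ?ltW.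
Qed.

(** The companion of [cot_decr] for even solutions: here the derivative of the numerator is
[(nu - mu) * (cosl mu x * cosl nu x)]. *)
Lemma tan_incr mu nu h : mu < nu -> 0 < h -> Num.sqrt nu * h < pi / 2 ->
  mu * (sinl mu h / cosl mu h) < nu * (sinl nu h / cosl nu h).
Proof.
move=> mn h0 hp; have hm := sqrt_mul_lt (ltW mn) (ltW h0) hp.
have cn := cosl_gt0 (ltW h0) hp; have cm := cosl_gt0 (ltW h0) hm.
rewrite !mulrA ltr_pdivrMr// mulrAC ltr_pdivlMr// -subr_gt0.
apply: (@pos_from_derive
  (fun x => nu * sinl nu x * cosl mu x - mu * sinl mu x * cosl nu x)
  (fun x => (nu - mu) * (cosl mu x * cosl nu x))) => //.
- by rewrite !sinl0 !(mulr0, mul0r) subrr.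
- move=> x; have h1 := is_derive_cosl mu x; have h2 := is_derive_sinl mu x.
  have h3 := is_derive_cosl nu x; have h4 := is_derive_sinl nu x.
  have h5 := is_deriveZ nu h4; have h6 := is_deriveZ mu h2.
  apply: is_derive_eq; rewrite /GRing.scale/=; ring.
- move=> x /andP[x0 xh]; rewrite mulr_gt0 ?subr_gt0// mulr_gt0// cosl_gt0 ?ltW//.
    by apply: le_lt_trans hm; rewrite ler_wpM2l ?sqrtr_ge0 ?ltW.
  by apply: le_lt_trans hp; rewrite ler_wpM2l ?sqrtr_ge0 ?ltW.
Qed.

(** A solution on an interval of length [L] with end values [y] and [z] has energy
[qdiff / 2 * |y - z|^2 - qsum / 2 * |y + z|^2]: the odd and the even part about the midpoint
decouple. Each coefficient is monotone in mu. *)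
Definition qdiff mu L := (cosl mu L + 1) / sinl mu L.
Definition qsum mu L := (1 - cosl mu L) / sinl mu L.

Lemma sqrt_mul_half_lt mu L : Num.sqrt mu * L < pi -> Num.sqrt mu * (L / 2) < pi / 2.
Proof. by rewrite mulrA ltr_pM2r. Qed.

Lemma qdiffE mu L : 0 < L -> Num.sqrt mu * L < pi ->
  qdiff mu L = cosl mu (L / 2) / sinl mu (L / 2).
Proof.
move=> L0 /sqrt_mul_half_lt h; have L20 : 0 < L / 2 by rewrite divr_gt0.
have c0 := cosl_gt0 (ltW L20) h.
have s0 : 0 < sinl mu (L / 2).
  by apply: sinl_gt0 => //; apply: lt_le_trans h _; rewrite ler_piMr ?pi_ge0//; lra.
rewrite /qdiff [X in cosl mu X](splitr L) [X in sinl mu X](splitr L) coslD sinlD.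
have := pythagoras mu (L / 2); move: (cosl _ _) c0 (sinl _ _) s0 => c c0 s s0 E.
have -> : c * c - mu * (s * s) + 1 = 2 * c * c by rewrite -[X in _ + X]E; ring.
have sn : s != 0 by rewrite gt_eqF.
have cn : c != 0 by rewrite gt_eqF.
have sc : s * c + c * s != 0 by rewrite gt_eqF// addr_gt0 ?mulr_gt0.
by field; rewrite ?sn ?cn ?sc.
Qed.

Lemma qsumE mu L : 0 < L -> Num.sqrt mu * L < pi ->
  qsum mu L = mu * (sinl mu (L / 2) / cosl mu (L / 2)).
Proof.
move=> L0 /sqrt_mul_half_lt h; have L20 : 0 < L / 2 by rewrite divr_gt0.
have c0 := cosl_gt0 (ltW L20) h.
have s0 : 0 < sinl mu (L / 2).
  by apply: sinl_gt0 => //; apply: lt_le_trans h _; rewrite ler_piMr ?pi_ge0//; lra.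
rewrite /qsum [X in cosl mu X](splitr L) [X in sinl mu X](splitr L) coslD sinlD.
have := pythagoras mu (L / 2); move: (cosl _ _) c0 (sinl _ _) s0 => c c0 s s0 E.
have -> : 1 - (c * c - mu * (s * s)) = 2 * mu * s * s by rewrite -[X in X - _]E; ring.
have sn : s != 0 by rewrite gt_eqF.
have cn : c != 0 by rewrite gt_eqF.
have sc : s * c + c * s != 0 by rewrite gt_eqF// addr_gt0 ?mulr_gt0.
by field; rewrite ?sn ?cn ?sc.
Qed.

Lemma qdiff_decr mu nu L : mu < nu -> 0 < L -> Num.sqrt nu * L < pi ->
  qdiff nu L < qdiff mu L.
Proof.
move=> mn L0 hn; have hm := sqrt_mul_lt (ltW mn) (ltW L0) hn.
rewrite !qdiffE//; apply: cot_decr => //; first by rewrite divr_gt0.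
by apply: lt_le_trans (sqrt_mul_half_lt hn) _; rewrite ler_piMr ?pi_ge0//; lra.
Qed.

Lemma qsum_incr mu nu L : mu < nu -> 0 < L -> Num.sqrt nu * L < pi ->
  qsum mu L < qsum nu L.
Proof.
move=> mn L0 hn; have hm := sqrt_mul_lt (ltW mn) (ltW L0) hn.
rewrite !qsumE//; apply: tan_incr => //; first by rewrite divr_gt0.
exact: sqrt_mul_half_lt.
Qed.

Lemma qsum0 L : qsum 0 L = 0.
Proof. by rewrite /qsum /cosl lexx sqrtr0 mul0r cos0 subrr mul0r. Qed.

Lemma qdiff0 L : qdiff 0 L = 2 / L.
Proof. by rewrite /qdiff /cosl lexx sqrtr0 mul0r cos0 /sinl ltxx eqxx. Qed.

(** The value at mu = [k ^+ 2] of [sinl mu L], as a function that is continuous in [k] at 0 too. *)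
Definition sink (L k : R) : R := if k == 0 then L else sin (k * L) / k.

Lemma continuous_sink L : continuous (sink L).
Proof.
move=> k; have [->|k0] := eqVneq k 0.
  apply/continuous_withinNx; rewrite {2}/sink eqxx.
  have dsin : is_derive (0 : R) 1 (fun k => sin (L * k)) L.
    have := is_derive_scale (is_derive_sin (L * 0)).
    by rewrite mulr0 cos0 mulr1.
  have H : h^-1 *: (sin (L * (h *: (1 : R) + 0)) - sin (L * 0)) @[h --> 0^'] --> L.
    rewrite -[X in _ --> X](@derive_val _ _ _ _ _ _ _ dsin).
    exact: (@ex_derive _ _ _ _ _ _ _ dsin).
  apply: cvg_trans H; apply: near_eq_cvg; near=> h.
  have h0 : h != 0 by near: h; exact: nbhs_dnbhs_neq.
  rewrite /sink (negPf h0) /GRing.scale/= addr0 mulr1 mulr0 sin0 subr0.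
  by rewrite mulrC [L * h]mulrC.
have : {for (k : R), continuous (fun k : R => sin (k * L) / k)}.
  apply: continuousM.
    apply: (continuous_comp (f := fun k : R => k * L)); last exact: continuous_sin.
    by apply: continuousM; [exact: cvg_id|exact: cvg_cst].
  exact: inv_continuous.
rewrite /continuous_at /sink (negPf k0); apply: cvg_trans; apply: near_eq_cvg.
near=> h; have -> // : (h == 0) = false.
by apply/negbTE; near: h; exact: (cvgr_neq0 k cvg_id).
Unshelve. all: by end_near. Qed.

Lemma cosl_cont L : exists2 f : R -> R, continuous f &
  forall mu, 0 <= mu -> cosl mu L = f mu.
Proof.
exists (fun mu => cos (Num.sqrt mu * L)) => [mu|mu m0]; last by rewrite /cosl m0.
apply: continuous_comp; last exact: continuous_cos.
by apply: continuousM; [exact: sqrt_continuous|exact: cvg_cst].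
Qed.

Lemma sinl_cont L : exists2 f : R -> R, continuous f &
  forall mu, 0 <= mu -> sinl mu L = f mu.
Proof.
exists (fun mu => sink L (Num.sqrt mu)) => [mu|mu].
  apply: continuous_comp; [exact: sqrt_continuous|exact: continuous_sink].
rewrite le_eqVlt /sink /sinl => /orP[/eqP <-|m0].
  by rewrite ltxx sqrtr0 !eqxx.
by rewrite m0 gt_eqF ?sqrtr_gt0.
Qed.

End FundamentalPair.

(** * Regularity and traces on an edge *)

Section RealEdge.
Context {R : realType}.
Variable (l : R).
Hypothesis l0 : 0 < l.
Implicit Types (f g h phi : R -> R) (a b x : R).
Notation mu := (@lebesgue_measure R).
Notation I := (`]0, l[%classic : set R).
Notation "f =ae g" := (\forall x \ae mu, I x -> f x = g x) (at level 70).

(** For a classical solution [A cosl + B sinl] the constants are [A = f cosl - g sinl] and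
[B = k f sinl + g cosl], where [g] is the derivative. For weak derivatives these two functions
still have weak derivative zero, so they are constant almost everywhere, and
[pythagoras] recovers [f]. *)
Lemma regularity k f g h : L1 l f -> L1 l g -> L1 l h ->
  is_weak_derivative l f g -> is_weak_derivative l g h ->
  h =ae (fun x => - k * f x) -> exists A B, f =ae sol k A B.
Proof.
move=> Lf Lg Lh wf wg hf.
have Lkf : L1 l (fun x => - k * f x) by exact: L1Z.
have {h Lh hf}wg : is_weak_derivative l g (fun x => - k * f x).
  by apply: (weak_ae Lg Lg Lh Lkf _ hf wg); exact: aeW.
have cc : continuous (cosl k : R -> R) by exact/smooth_continuous/smooth_cosl.
have cs : continuous (sinl k : R -> R) by exact/smooth_continuous/smooth_sinl.
have Lfc := L1_continuousM Lf cc; have Lfs := L1_continuousM Lf cs.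
have Lgc := L1_continuousM Lg cc; have Lgs := L1_continuousM Lg cs.
have Lkfc := L1_continuousM Lkf cc; have Lkfs := L1_continuousM Lkf cs.
have key (u v : R -> R) : L1 l u -> L1 l v -> is_weak_derivative l u v ->
    (forall x, v x = 0) -> exists c, u =ae (fun=> c).
  move=> Lu Lv w v0; apply: du_Bois_Reymond => // phi tphi; rewrite w//.
  rewrite (@eq_Rintegral _ _ _ mu I (fun=> 0)) ?Rintegral_cst ?mul0r ?oppr0//.
  by move=> x _; rewrite v0 mul0r.
have Ldc (u : R -> R) : L1 l u -> L1 l (fun x => u x * derive1 (cosl k) x).
  by move=> ?; apply: L1_continuousM => //; exact/smooth_continuous/smooth_derive1/smooth_cosl.
have Lds (u : R -> R) : L1 l u -> L1 l (fun x => u x * derive1 (sinl k) x).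
  by move=> ?; apply: L1_continuousM => //; exact/smooth_continuous/smooth_derive1/smooth_sinl.
have [A HA] : exists c, (fun x => f x * cosl k x + -1 * (g x * sinl k x)) =ae (fun=> c).
  have w1 := weakM Lf Lg (@smooth_cosl R k) wf.
  have w2 := weakM Lg Lkf (@smooth_sinl R k) wg.
  have L2' : L1 l (fun x => - k * f x * sinl k x + g x * derive1 (sinl k) x).
    by apply: L1D => //; exact: Lds.
  have L1' : L1 l (fun x => g x * cosl k x + f x * derive1 (cosl k) x).
    by apply: L1D => //; exact: Ldc.
  have w3 := @weakZ R l _ _ (-1) Lgs L2' w2.
  apply: (key _ _ _ _ (weakD Lfc (L1Z _ Lgs) L1' (L1Z _ L2') w1 w3)).
  - by apply: L1D => //; exact: L1Z.
  - by apply: L1D => //; exact: L1Z.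
  - by move=> x; rewrite derive1_cosl derive1_sinl; ring.
have [B HB] : exists c, (fun x => k * (f x * sinl k x) + g x * cosl k x) =ae (fun=> c).
  have w1 := weakM Lf Lg (@smooth_sinl R k) wf.
  have w2 := weakM Lg Lkf (@smooth_cosl R k) wg.
  have L2' : L1 l (fun x => - k * f x * cosl k x + g x * derive1 (cosl k) x).
    by apply: L1D => //; exact: Ldc.
  have L1' : L1 l (fun x => g x * sinl k x + f x * derive1 (sinl k) x).
    by apply: L1D => //; exact: Lds.
  have w3 := @weakZ R l _ _ k Lfs L1' w1.
  apply: (key _ _ _ _ (weakD (L1Z _ Lfs) Lgc (L1Z _ L1') L2' w3 w2)).
  - by apply: L1D => //; exact: L1Z.
  - by apply: L1D => //; exact: L1Z.
  - by move=> x; rewrite derive1_cosl derive1_sinl; ring.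
exists A, B; have := ae_and HA HB; apply: ae_imp => x [hA hB] xI.
rewrite /sol -(hA xI) -(hB xI).
have := pythagoras k x; move: (cosl k x) (sinl k x) => c s E.
rewrite -[LHS]mulr1 -[X in _ * X]E; ring.
Qed.

Lemma weak_derivative_spec f : (exists g, L2 l g /\ is_weak_derivative l f g) ->
  L2 l (weak_derivative l f) /\ is_weak_derivative l f (weak_derivative l f).
Proof. by move=> /(xgetPex (fun=> 0)). Qed.

(** The weak derivative selected by choice need not be [derive1 F], but weak derivatives are
unique up to a null set. *)
Lemma weak_derivative_smooth f F : L2 l f -> smooth F -> f =ae F ->
  L2 l (weak_derivative l f) /\ weak_derivative l f =ae derive1 F.
Proof.
move=> Lf sF fF.
have cF := smooth_continuous sF; have cF' := smooth_continuous (smooth_derive1 sF).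
have w : is_weak_derivative l f (derive1 F).
  apply: (weak_ae _ _ _ _ _ _ (weak_smooth l0 sF)).
  - exact: L1_continuous.
  - exact: L2_L1.
  - exact: L1_continuous.
  - exact: L1_continuous.
  - by apply: ae_imp fF => x /[apply].
  - exact: aeW.
have [L w'] : L2 l (weak_derivative l f) /\ is_weak_derivative l f (weak_derivative l f).
  by apply: weak_derivative_spec; exists (derive1 F); split=> //; exact: L2_continuous.
split=> //; apply: weak_unique w' w; first exact: L2_L1.
exact: L1_continuous.
Qed.

Lemma Sobolev_smooth n F : smooth F -> Sobolev n l F.
Proof.
elim: n F => [|n IH] F sF /=; first exact/L2_continuous/smooth_continuous.
split; first exact/L2_continuous/smooth_continuous.
exists (derive1 F); split; [exact: weak_smooth|exact/IH/smooth_derive1].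
Qed.

Lemma Sobolev_L2 n f : Sobolev n l f -> L2 l f.
Proof. by case: n => [|n] // []. Qed.

Lemma Sobolev2_regular k f : Sobolev 2 l f ->
  weak_derivative l (weak_derivative l f) =ae (fun x => - k * f x) ->
  exists A B, f =ae sol k A B.
Proof.
move=> [Lf [g0 [wf [Lg0 [h0 [wg0 Lh0]]]]]] H.
have [Lg wg] : L2 l (weak_derivative l f) /\ is_weak_derivative l f (weak_derivative l f).
  by apply: weak_derivative_spec; exists g0.
have [Lh wh] : L2 l (weak_derivative l (weak_derivative l f)) /\
   is_weak_derivative l (weak_derivative l f) (weak_derivative l (weak_derivative l f)).
  apply: weak_derivative_spec; exists h0; split=> //.
  apply: (weak_ae _ _ _ _ _ _ wg0); try exact: L2_L1.
    by apply: (weak_unique _ _ wf wg); exact: L2_L1.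
  exact: aeW.
by apply: (regularity _ _ _ wg wh H); exact: L2_L1.
Qed.

(** If the values differed at [a], they would differ on a nontrivial interval next to [a]. *)
Lemma continuous_eq_endpoints (F G : R -> R) : continuous F ->
  {within `[0, l], continuous G} -> F =ae G -> forall a, 0 <= a <= l -> F a = G a.
Proof.
move=> cF cG FG a al; apply/eqP/contraT => FGa.
(* With this tolerance F and G differ wherever both are close to their values at a. *)
pose e := `|F a - G a| / 2.
have e0 : 0 < e by rewrite divr_gt0// normr_gt0 subr_eq0.
have aI : `[0, l]%classic a by rewrite /= in_itv.
have /cvgrPdist_lt /(_ e e0) := cG a.
rewrite /prop_near1 /nbhs/= -(nbhs_subspace_in aI) => HG.
have /cvgrPdist_lt /(_ e e0) HF := cF a.
have : nbhs a ([set t | `|F a - F t| < e] `&`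
    [set t | `[0, l]%classic t -> `|G a - G t| < e]) by exact: filterI.
move=> /nbhs_ballP [d /= d0 Hd].
pose a' := Num.max 0 (a - d); pose b' := Num.min l (a + d).
case/andP: al => a0 al.
have [|||x /andP[ax xb] xFG] := @ae_exists R l (fun x => F x = G x) a' b' FG.
- by rewrite le_max lexx.
- rewrite gt_max !lt_min l0/= ltrBlDr; lra.
- by rewrite ge_min lexx.
move: ax xb; rewrite gt_max lt_min => /andP[x0 ax] /andP[xl xb].
have [|h1 h2] := Hd x; first by rewrite /ball/= ltr_distlC; lra.
have {}h2 : `|G a - G x| < e by apply: h2; rewrite /= in_itv/= !ltW.
have : `|F a - G a| < e + e.
  rewrite (_ : F a - G a = (F a - F x) - (G a - G x)); last by rewrite xFG; ring.
  by apply: le_lt_trans (ler_normB _ _) _; apply: ltrD.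
by rewrite /e -splitr ltxx.
Qed.

Lemma trace_continuous f F a : continuous F -> f =ae F -> 0 <= a <= l ->
  trace l f a = F a.
Proof.
move=> cF fF al; rewrite /trace; apply: xget_unique.
  exists F; split=> //; exact: continuous_subspaceT.
move=> c [g [cg fg <-]]; apply/esym; apply: continuous_eq_endpoints => //.
by have := ae_and fF fg; apply: ae_imp => x [h1 h2] xI; rewrite -h1// h2.
Qed.

End RealEdge.

(** * Complex-valued functions on an edge *)

Section ComplexEdge.
Context {R : realType}.
Implicit Types (mu x : R) (A B : R[i]) (u U W : R -> R[i]).
Notation leb := (@lebesgue_measure R).

Definition csol mu A B x : R[i] :=
  A * (cosl mu x)%:C%C + B * (sinl mu x)%:C%C.

Lemma cReD (z w : R[i]) : complex.Re (z + w) = complex.Re z + complex.Re w.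
Proof. by case: z; case: w. Qed.
Lemma cImD (z w : R[i]) : complex.Im (z + w) = complex.Im z + complex.Im w.
Proof. by case: z; case: w. Qed.
Lemma cReB (z w : R[i]) : complex.Re (z - w) = complex.Re z - complex.Re w.
Proof. by case: z; case: w. Qed.
Lemma cImB (z w : R[i]) : complex.Im (z - w) = complex.Im z - complex.Im w.
Proof. by case: z; case: w. Qed.
Lemma cReN (z : R[i]) : complex.Re (- z) = - complex.Re z.
Proof. by case: z. Qed.
Lemma cImN (z : R[i]) : complex.Im (- z) = - complex.Im z.
Proof. by case: z. Qed.
Lemma cReMr (z : R[i]) x : complex.Re (z * x%:C%C) = complex.Re z * x.
Proof. by case: z => a b /=; rewrite mulr0 subr0. Qed.
Lemma cImMr (z : R[i]) x : complex.Im (z * x%:C%C) = complex.Im z * x.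
Proof. by case: z => a b /=; rewrite mulr0 add0r. Qed.
Lemma cReMl (z : R[i]) x : complex.Re (x%:C%C * z) = x * complex.Re z.
Proof. by case: z => a b /=; rewrite mul0r subr0. Qed.
Lemma cImMl (z : R[i]) x : complex.Im (x%:C%C * z) = x * complex.Im z.
Proof. by case: z => a b /=; rewrite mul0r addr0. Qed.

Lemma complex_eqP (z w : R[i]) : complex.Re z = complex.Re w ->
  complex.Im z = complex.Im w -> z = w.
Proof. by case: z => a b; case: w => c d /= -> ->. Qed.

Definition csmooth U := smooth (rpart U) /\ smooth (ipart U).
Definition cder U x : R[i] :=
  Complex (derive1 (rpart U) x) (derive1 (ipart U) x).

Lemma rpart_csol mu A B :
  rpart (csol mu A B) = sol mu (complex.Re A) (complex.Re B).
Proof. by apply/funext => x; rewrite /rpart cReD !cReMr. Qed.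

Lemma ipart_csol mu A B :
  ipart (csol mu A B) = sol mu (complex.Im A) (complex.Im B).
Proof. by apply/funext => x; rewrite /ipart cImD !cImMr. Qed.

Lemma csmooth_csol mu A B : csmooth (csol mu A B).
Proof. by split; rewrite ?rpart_csol ?ipart_csol; exact: smooth_sol. Qed.

Lemma cder_csol mu A B : cder (csol mu A B) = csol mu B (- mu%:C%C * A).
Proof.
apply/funext => x; rewrite /cder rpart_csol ipart_csol !derive1_sol.
apply: complex_eqP => /=.
  by rewrite -[RHS]/(rpart _ _) rpart_csol [in RHS]mulNr cReN cReMl [in LHS]mulNr.
by rewrite -[RHS]/(ipart _ _) ipart_csol [in RHS]mulNr cImN cImMl [in LHS]mulNr.
Qed.

Lemma csol0 mu A B : csol mu A B 0 = A.
Proof. by rewrite /csol cosl0 sinl0 mulr1 mulr0 addr0. Qed.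

Lemma csol_lin A B x : csol 0 A B x = A + B * x%:C%C.
Proof. by rewrite /csol /cosl /sinl lexx ltxx eqxx sqrtr0 mul0r cos0 mulr1. Qed.

Lemma csmooth_sub U W : csmooth U -> csmooth W -> csmooth (fun x => U x - W x).
Proof.
move=> [sU sU'] [sW sW']; split.
  rewrite (_ : rpart _ = fun x => rpart U x - rpart W x); first exact: smoothB.
  by apply/funext => x; rewrite /rpart cReB.
rewrite (_ : ipart _ = fun x => ipart U x - ipart W x); first exact: smoothB.
by apply/funext => x; rewrite /ipart cImB.
Qed.

Lemma cder_sub U W : csmooth U -> csmooth W ->
  cder (fun x => U x - W x) = fun x => cder U x - cder W x.
Proof.
move=> [sU sU'] [sW sW']; apply/funext => x; apply: complex_eqP.
  rewrite cReB /= (_ : rpart _ = fun x => rpart U x - rpart W x); last first.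
    by apply/funext => y; rewrite /rpart cReB.
  by rewrite !derive1E; apply: deriveB; exact: smooth_derivable.
rewrite cImB /= (_ : ipart _ = fun x => ipart U x - ipart W x); last first.
  by apply/funext => y; rewrite /ipart cImB.
by rewrite !derive1E; apply: deriveB; exact: smooth_derivable.
Qed.

Lemma csmooth_cder U : csmooth U -> csmooth (cder U).
Proof. by move=> [sU sU']; split; exact: smooth_derive1. Qed.

Section Edge.
Variable l : R.
Hypothesis l0 : 0 < l.
Notation I := (`]0, l[%classic : set R).
Notation "f =ae g" := (\forall x \ae leb, I x -> f x = g x) (at level 70).

Lemma cae_parts u U : (u =ae U) <->
  (rpart u =ae rpart U) /\ (ipart u =ae ipart U).
Proof.
split=> [h|[h1 h2]].
  by split; apply: ae_imp h => x /[apply] uU; rewrite /rpart /ipart uU.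
have := ae_and h1 h2; apply: ae_imp => x [a1 a2] xI.
by apply: complex_eqP; [exact: a1|exact: a2].
Qed.

Lemma Ctrace_smooth u U a : csmooth U -> u =ae U -> 0 <= a <= l ->
  Ctrace l u a = U a.
Proof.
move=> [sU sU'] /cae_parts[h1 h2] al; apply: complex_eqP => /=.
  by rewrite (trace_continuous l0 (smooth_continuous sU) h1 al).
by rewrite (trace_continuous l0 (smooth_continuous sU') h2 al).
Qed.

Lemma CSobolev_smooth n U : csmooth U -> CSobolev n l U.
Proof. by move=> [sU sU']; split; exact: Sobolev_smooth. Qed.

Lemma CSobolev_L2 n u : CSobolev n l u -> CSobolev 0 l u.
Proof. by move=> [h1 h2]; split; [exact: Sobolev_L2 h1|exact: Sobolev_L2 h2]. Qed.

Lemma Cwd_smooth u U : CSobolev 0 l u -> csmooth U -> u =ae U ->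
  CSobolev 0 l (Cweak_derivative l u) /\ Cweak_derivative l u =ae cder U.
Proof.
move=> [L L'] [sU sU'] /cae_parts[h1 h2].
have [w1 e1] := weak_derivative_smooth l0 L sU h1.
have [w2 e2] := weak_derivative_smooth l0 L' sU' h2.
by split; [split|apply/cae_parts; split].
Qed.

Lemma Cwd2_smooth u U : CSobolev 0 l u -> csmooth U -> u =ae U ->
  Cweak_derivative l (Cweak_derivative l u) =ae cder (cder U).
Proof.
move=> L sU uU; have [L' e] := Cwd_smooth L sU uU.
by have [] := Cwd_smooth L' (csmooth_cder sU) e.
Qed.

Lemma edge_eigenfunction mu u : CSobolev 2 l u ->
  (fun x => - Cweak_derivative l (Cweak_derivative l u) x) =ae
  (fun x => mu%:C%C * u x) ->
  exists A B, u =ae csol mu A B.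
Proof.
move=> [S1 S2] /cae_parts[h1 h2].
have [|A1 [B1 e1]] := @Sobolev2_regular R l l0 mu _ S1.
  by apply: ae_imp h1 => x /[apply]; rewrite /rpart cReN cReMl mulNr => <-; rewrite opprK.
have [|A2 [B2 e2]] := @Sobolev2_regular R l l0 mu _ S2.
  by apply: ae_imp h2 => x /[apply]; rewrite /ipart cImN cImMl mulNr => <-; rewrite opprK.
exists (Complex A1 A2), (Complex B1 B2); apply/cae_parts.
by rewrite rpart_csol ipart_csol.
Qed.

End Edge.
End ComplexEdge.

(** * Eigenfunctions of the Krein Laplacian *)

Section KreinData.
Context {R : realType} (G : metric_graph R).
Notation leb := (@lebesgue_measure R).
Notation V := (vertex G).
Notation E := (edge G).
Implicit Types (mu : R) (a : V -> R[i]) (B : E -> R[i]) (f g : gfun G).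

(** The parameters are the vertex values [a] and the derivatives [B] at the initial points
of the edges. *)
Definition eigfun mu a B : gfun G := fun e => csol mu (a (ini e)) (B e).

(** The slope of the affine function with the same vertex values, the harmonic part of the
eigenfunction. *)
Definition slope a (e : E) : R[i] := (a (ter e) - a (ini e)) / (len e)%:C%C.

(** Continuity at the terminal points, and equality of the normal derivatives of the
eigenfunction and of its harmonic part. *)
Definition Krein_data mu a B : Prop :=
  (forall e, csol mu (a (ini e)) (B e) (len e) = a (ter e)) /\
  forall v, \sum_(e : E | ter e == v)
        (csol mu (B e) (- mu%:C%C * a (ini e)) (len e) - slope a e) -
     \sum_(e : E | ini e == v) (B e - slope a e) = 0.

Let leneq0 (e : E) : (len e)%:C%C != 0 :> R[i].
Proof. by rewrite eq_complex /= eqxx andbT gt_eqF// len_gt0. Qed.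

Let end0 (e : E) : 0 <= (0 : R) <= len e.
Proof. by rewrite lexx ltW// len_gt0. Qed.

Let end1 (e : E) : 0 <= len e <= len e.
Proof. by rewrite lexx ltW// len_gt0. Qed.

Lemma normal_derivative_smooth u (U : E -> R -> R[i]) v :
  edge_Sobolev 2 u -> (forall e, csmooth (U e)) -> gfun_eq u U ->
  normal_derivative u v = \sum_(e : E | ter e == v) cder (U e) (len e) -
    \sum_(e : E | ini e == v) cder (U e) 0.
Proof.
move=> Su sU uU; rewrite /normal_derivative.
have H e x : 0 <= x <= len e ->
    Ctrace (len e) (Cweak_derivative (len e) (u e)) x = cder (U e) x.
  move=> xe; apply: Ctrace_smooth => //; first exact: len_gt0.
    exact: csmooth_cder.
  by have [] := Cwd_smooth (len_gt0 e) (CSobolev_L2 (Su e)) (sU e) (uU e).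
by congr (_ - _); apply: eq_bigr => e _; exact: H.
Qed.

(** The harmonic part [h] has the vertex values of [f], since [u] vanishes at the vertices;
so [h] is the affine interpolant and the condition on the normal derivatives of [u] becomes the
vertex condition. *)
Lemma Krein_data_of_eigenfunction mu f : Krein_eigenspace mu f ->
  exists a B, Krein_data mu a B /\ gfun_eq f (eigfun mu a B).
Proof.
move=> [[[Sf [_ [a fa]]] [u [h [[Su _ u0 du0] [[Sh [_ [a' ha]]] hh] fuh]]]] feig].
have /choice [A HA] : forall e, exists A : R[i], exists B : R[i],
    \forall x \ae leb, `]0, len e[%classic x -> f e x = csol mu A B x.
  by move=> e; exact: edge_eigenfunction (len_gt0 e) _ _ (Sf e) (feig e).
have {HA} /choice [B HB] := HA.
have /choice [A' HA'] : forall e, exists A : R[i], exists B : R[i],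
    \forall x \ae leb, `]0, len e[%classic x -> h e x = csol 0 A B x.
  move=> e; apply: (edge_eigenfunction (len_gt0 e) (Sh e)).
  by have := hh e; apply: ae_imp => x hx xI; rewrite rmorph0 mul0r; exact: hx.
have {HA'} /choice [B' HB'] := HA'.
have AE e : A e = a (ini e).
  have [<- _] := fa e.
  by rewrite (Ctrace_smooth (len_gt0 e) _ (HB e))// ?csol0//; exact: csmooth_csol.
have AE' e : A' e = a' (ini e).
  have [<- _] := ha e.
  by rewrite (Ctrace_smooth (len_gt0 e) _ (HB' e))// ?csol0//; exact: csmooth_csol.
have TE e : csol mu (a (ini e)) (B e) (len e) = a (ter e).
  have [_ <-] := fa e; rewrite -AE.
  by rewrite (Ctrace_smooth (len_gt0 e) _ (HB e))//; exact: csmooth_csol.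
pose U (e : E) x := csol mu (A e) (B e) x - csol 0 (A' e) (B' e) x.
have sU e : csmooth (U e) by apply: csmooth_sub; exact: csmooth_csol.
have uU : gfun_eq u U.
  move=> e; have := ae_and (ae_and (HB e) (HB' e)) (fuh e).
  by apply: ae_imp => x [[h1 h2] h3] xI; rewrite /U -h1// -h2// h3// addrK.
have U0 e : U e 0 = 0 /\ U e (len e) = 0.
  have [u00 u01] := u0 e.
  rewrite -(Ctrace_smooth (len_gt0 e) (sU e) (uU e) (end0 e)) u00.
  by rewrite -(Ctrace_smooth (len_gt0 e) (sU e) (uU e) (end1 e)) u01.
have A'E e : A' e = A e.
  by have [/eqP] := U0 e; rewrite /U !csol0 subr_eq0 eq_sym => /eqP.
have B'E e : B' e = slope a e.
  have [_ /eqP] := U0 e; rewrite /U csol_lin A'E AE TE subr_eq0 addrC => /eqP.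
  by move=> E1; rewrite /slope E1 addrK mulfK ?leneq0.
exists a, B; split; last by move=> e; have := HB e; rewrite /eigfun AE.
split=> // v; rewrite -[RHS](du0 v) (normal_derivative_smooth _ Su sU uU).
have dU e x : cder (U e) x = csol mu (B e) (- mu%:C%C * a (ini e)) x - slope a e.
  rewrite /U cder_sub; [|exact: csmooth_csol..].
  by rewrite !cder_csol AE B'E csol_lin oppr0 !mul0r addr0.
by congr (_ - _); apply: eq_bigr => e _; rewrite dU ?csol0.
Qed.

(** Conversely the decomposition is recovered by taking the affine interpolant for [h]. *)
Lemma eigenfunction_of_Krein_data mu a B : Krein_data mu a B ->
  Krein_eigenspace mu (eigfun mu a B).
Proof.
move=> [TE KE].
pose h : gfun G := fun e => csol 0 (a (ini e)) (slope a e).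
pose u : gfun G := fun e x => eigfun mu a B e x - h e x.
have sf e : csmooth (eigfun mu a B e) by exact: csmooth_csol.
have sh e : csmooth (h e) by exact: csmooth_csol.
have su e : csmooth (u e) by exact: csmooth_sub.
have S n (w : gfun G) : (forall e, csmooth (w e)) -> edge_Sobolev n w.
  by move=> sw e; exact: CSobolev_smooth (len_gt0 e) _ _ (sw e).
have tr (w : gfun G) e x : csmooth (w e) -> 0 <= x <= len e ->
    Ctrace (len e) (w e) x = w e x.
  by move=> sw xe; apply: Ctrace_smooth => //; [exact: len_gt0|exact: aeW].
have hter e : h e (len e) = a (ter e).
  by rewrite /h csol_lin /slope divfK ?leneq0// addrC subrK.
have va : vertex_values (eigfun mu a B) a.
  by move=> e; rewrite !tr// {1}/eigfun csol0 /eigfun TE.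
have vh : vertex_values h a by move=> e; rewrite !tr// {1}/h csol0 hter.
have vu : vertex_values u (fun=> 0).
  by move=> e; rewrite !tr// /u {1 2}/eigfun {1}/h !csol0 TE hter !subrr.
have wd2 (w : gfun G) e : csmooth (w e) -> \forall x \ae leb, `]0, len e[%classic x ->
    minus_second_derivative w e x = - cder (cder (w e)) x.
  move=> sw; have := Cwd2_smooth (len_gt0 e) (CSobolev_smooth (len_gt0 e) 0 sw) sw (aeW _ (fun x _ => erefl)).
  by apply: ae_imp => x /[apply] <-.
split; last first.
  move=> e; have := wd2 (eigfun mu a B) e (sf e); apply: ae_imp => x /[apply] ->.
  by rewrite /eigfun !cder_csol /csol; ring.
split; first by split; [exact: S|split; [exact: S|exists a]].
exists u, h; split.
- split; [exact: S|by split; [exact: S|exists (fun=> 0)]|by []|].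
  move=> v; rewrite -[RHS](KE v).
  rewrite (@normal_derivative_smooth u u)//; [|exact: S|by move=> e; exact: aeW].
  have du e x : cder (u e) x = csol mu (B e) (- mu%:C%C * a (ini e)) x - slope a e.
    rewrite /u cder_sub//.
    by rewrite !cder_csol csol_lin oppr0 !mul0r addr0.
  by congr (_ - _); apply: eq_bigr => e _; rewrite du ?csol0.
- split; first by split; [exact: S|split; [exact: S|exists a]].
  move=> e; have := wd2 h e (sh e); apply: ae_imp => x /[apply] ->.
  by rewrite /h !cder_csol csol_lin oppr0 !mul0r addr0 oppr0.
- by move=> e; apply: aeW => x _; rewrite /u subrK.
Qed.

End KreinData.

(** * Inertia of hermitian matrices *)

Section Inertia.
Context {R : realType} {n : nat}.
Notation C := R[i].
Implicit Types (A : 'M[C]_n) (x : 'rV[C]_n) (S : {set 'I_n}).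

Definition sqn (z : C) : R := complex.Re z ^+ 2 + complex.Im z ^+ 2.
Definition nrm2 m (x : 'rV[C]_m) : R := \sum_i sqn (x 0 i).
Definition hform A x : R := complex.Re ((x *m A *m x^t*) 0 0).

Lemma sqn_ge0 z : 0 <= sqn z.
Proof. by rewrite addr_ge0 ?sqr_ge0. Qed.

Lemma sqn_eq0 z : (sqn z == 0) = (z == 0).
Proof.
by case: z => a b; rewrite /sqn/= paddr_eq0 ?sqr_ge0// !sqrf_eq0 eq_complex.
Qed.

Lemma mulC_conj (z : C) : z * z^* = (sqn z)%:C%C.
Proof.
case: z => a b; rewrite /sqn /=; apply: complex_eqP => /=.
  by rewrite mulrN opprK.
by rewrite mulrN addrC mulrC subrr.
Qed.

Lemma nrm2_ge0 m (x : 'rV[C]_m) : 0 <= nrm2 x.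
Proof. by apply: sumr_ge0 => i _; exact: sqn_ge0. Qed.

Lemma nrm2_eq0 m (x : 'rV[C]_m) : (nrm2 x == 0) = (x == 0).
Proof.
apply/eqP/eqP => [h|->]; last first.
  by rewrite /nrm2 big1// => i _; apply/eqP; rewrite sqn_eq0 mxE.
apply/rowP => i; rewrite mxE; apply/eqP; rewrite -sqn_eq0.
by move: h => /psumr_eq0P -> // j _; exact: sqn_ge0.
Qed.

Lemma nrm2_gt0 m (x : 'rV[C]_m) : (0 < nrm2 x) = (x != 0).
Proof. by rewrite lt_neqAle nrm2_ge0 andbT eq_sym nrm2_eq0. Qed.

Lemma nrm2E m (x : 'rV[C]_m) : (x *m x^t*) 0 0 = (nrm2 x)%:C%C.
Proof.
rewrite mxE /nrm2 rmorph_sum /=; apply: eq_bigr => i _.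
by rewrite !mxE mulC_conj.
Qed.

Definition coords A x := x *m (spectralmx A)^t*.
Definition eigval A (i : 'I_n) : R := complex.Re (spectral_diag A 0 i).

Lemma coordsK A x : coords A x *m spectralmx A = x.
Proof. exact: (mulmxKtV _ (spectral_unitarymx A)).
 Qed.

Lemma nrm2_coords A x : nrm2 (coords A x) = nrm2 x.
Proof.
suff : (nrm2 (coords A x))%:C%C = (nrm2 x)%:C%C :> C by case.
rewrite -!nrm2E /coords trmx_mul map_mxM !mulmxA map_trmx trmxK -map_mx_comp.
by rewrite (map_mx_id (@conjCK _)) (mulmxKtV _ (spectral_unitarymx A)).
Qed.

Lemma coords0 A x : coords A x = 0 -> x = 0.
Proof. by move=> h; rewrite -(coordsK A x) h mul0mx. Qed.

Variable (A : 'M[C]_n).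
Hypothesis hA : A \is hermsymmx.

Lemma spectral_eigval i : spectral_diag A 0 i = (eigval A i)%:C%C.
Proof.
have /mxOverP /(_ 0 i) := hermitian_spectral_diag_real hA.
rewrite /eigval; case: (spectral_diag A 0 i) => a b /CrealP [h].
by apply: complex_eqP => //=; lra.
Qed.

Lemma spectralE : A = (spectralmx A)^t* *m diag_mx (spectral_diag A) *m spectralmx A.
Proof.
rewrite -invmx_unitary ?spectral_unitarymx//.
by apply/orthomx_spectralP; exact: hermitian_normalmx.
Qed.

Lemma hformE x : hform A x = \sum_i eigval A i * sqn (coords A x 0 i).
Proof.
suff : (x *m A *m x^t*) 0 0 = (\sum_i eigval A i * sqn (coords A x 0 i))%:C%C.
  by rewrite /hform => ->.
have -> : x *m A *m x^t* = coords A x *m diag_mx (spectral_diag A) *m (coords A x)^t*.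
  rewrite {1}spectralE /coords trmx_mul map_mxM !mulmxA map_trmx trmxK -map_mx_comp.
  by rewrite (map_mx_id (@conjCK _)).
rewrite mxE rmorph_sum/=; apply: eq_bigr => i _.
rewrite mul_mx_diag !mxE spectral_eigval [X in X * _]mulrC -mulrA mulC_conj.
by rewrite rmorphM.
Qed.

Lemma mulmx_eq0_coords x : x *m A = 0 <-> forall i, eigval A i != 0 -> coords A x 0 i = 0.
Proof.
have E : (x *m A == 0) = (coords A x *m diag_mx (spectral_diag A) == 0).
  rewrite {1}spectralE !mulmxA -/(coords A x).
  apply/eqP/eqP => [h|->]; last by rewrite mul0mx.
  have := congr1 (fun M => M *m (spectralmx A)^t*) h.
  by rewrite mulmxtVK ?spectral_unitarymx// mul0mx.
split=> [/eqP|h]; last first.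
  apply/eqP; rewrite E; apply/eqP/rowP => i.
  rewrite mul_mx_diag [LHS]mxE [RHS]mxE spectral_eigval.
  by have [->|/h ->] := eqVneq (eigval A i) 0; rewrite ?mul0r// mulr0.
rewrite E => /eqP/rowP h i ei; move: (h i).
rewrite mul_mx_diag [LHS]mxE [RHS]mxE spectral_eigval.
by move/eqP; rewrite mulf_eq0 => /orP[/eqP//|]; rewrite eq_complex/= eqxx andbT (negPf ei).
Qed.

(** A subspace on which the spectral coordinates in [S] determine the vector embeds in a space
of dimension [#|S|]. *)
Lemma dim_le_coords k (W : 'M[C]_(k, n)) S : row_free W ->
  (forall v : 'rV[C]_k, (forall i, i \in S -> coords A (v *m W) 0 i = 0) -> v *m W = 0) ->
  (k <= #|S|)%N.
Proof.
move=> fW HW.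
pose M : 'M[C]_(k, #|S|) := \matrix_(i, j) coords A (row i W) 0 (enum_val j).
have ME (v : 'rV[C]_k) j : (v *m M) 0 j = coords A (v *m W) 0 (enum_val j).
  rewrite /coords -mulmxA !mxE; apply: eq_bigr => i _.
  by rewrite !mxE; congr (_ * _); apply: eq_bigr => l _; rewrite !mxE.
suff /eqP <- : row_free M by exact: rank_leq_col.
apply: inj_row_free => v vM; apply: (row_free_inj fW); rewrite mul0mx.
apply: HW => i iS; rewrite -(enum_rankK_in iS iS) -ME vM mxE//.
Qed.

Lemma spectral_subspace S : exists W : 'M[C]_(#|S|, n),
  row_free W /\ forall v : 'rV[C]_(#|S|), forall i, i \notin S -> coords A (v *m W) 0 i = 0.
Proof.
pose D : 'M[C]_(#|S|, n) := \matrix_(j, i) (enum_val j == i)%:R.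
have DE (v : 'rV[C]_(#|S|)) i : (v *m D) 0 i = \sum_j v 0 j * (enum_val j == i)%:R.
  by rewrite mxE; apply: eq_bigr => j _; rewrite mxE.
have cD v : coords A (v *m (D *m spectralmx A)) = v *m D.
  by rewrite /coords !mulmxA mulmxtVK// spectral_unitarymx.
exists (D *m spectralmx A); split=> [|v i iS].
  apply: inj_row_free => v h; have := cD v; rewrite h /coords mul0mx => /esym vD.
  apply/rowP => j; have /rowP/(_ (enum_val j)) := vD; rewrite DE !mxE => <-.
  rewrite (bigD1 j)//= eqxx mulr1 big1 ?addr0// => j' jj'.
  by rewrite (inj_eq enum_val_inj) (negPf jj') mulr0.
rewrite cD DE big1// => j _; case: eqP => [ji|_]; rewrite ?mulr0//.
by move: iS; rewrite -ji enum_valP.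
Qed.

Definition npos_set : {set 'I_n} := finset (fun i => eigval A i <= 0).
Definition neg_set : {set 'I_n} := finset (fun i => eigval A i < 0).
Definition pos_set : {set 'I_n} := finset (fun i => 0 < eigval A i).
Definition null_set : {set 'I_n} := finset (fun i => eigval A i == 0).

(** A vector of [W] without nonpositive components has nonnegative form, hence zero form, hence
is zero. *)
Lemma dim_le_npos k (W : 'M[C]_(k, n)) : row_free W ->
  (forall v : 'rV_k, hform A (v *m W) <= 0) -> (k <= #|npos_set|)%N.
Proof.
move=> fW hW;  apply: (@dim_le_coords k W npos_set fW) => v h; apply: (@coords0 A).
have := hW v; rewrite hformE => le0; apply/rowP => i; rewrite [RHS]mxE.
have [ei|ei] := leP (eigval A i) 0; first by apply: h; rewrite inE.
apply/eqP; rewrite -sqn_eq0.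
have ge0 j : true -> 0 <= eigval A j * sqn (coords A (v *m W) 0 j).
  move=> _; have [ej|ej] := leP (eigval A j) 0.
    by rewrite h ?inE// /sqn/= expr0n addr0 mulr0.
  by rewrite mulr_ge0 ?sqn_ge0// ltW.
have : \sum_j eigval A j * sqn (coords A (v *m W) 0 j) = 0.
  by apply/eqP; rewrite eq_le le0 sumr_ge0.
move=> /(psumr_eq0P ge0) /(_ i isT)/eqP.
by rewrite mulf_eq0 gt_eqF.
Qed.

Lemma dim_le_neg k (W : 'M[C]_(k, n)) : row_free W ->
  (forall v : 'rV_k, v *m W != 0 -> hform A (v *m W) < 0) -> (k <= #|neg_set|)%N.
Proof.
move=> fW hW; apply: (@dim_le_coords k W neg_set fW) => v h; apply/eqP/contraT => /hW.
rewrite hformE ltNge sumr_ge0// => i _.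
have [ei|ei] := ltP (eigval A i) 0; last by rewrite mulr_ge0 ?sqn_ge0.
by rewrite h ?inE// /sqn/= expr0n addr0 mulr0.
Qed.

Lemma dim_le_pos k (W : 'M[C]_(k, n)) : row_free W ->
  (forall v : 'rV_k, v *m W != 0 -> 0 < hform A (v *m W)) -> (k <= #|pos_set|)%N.
Proof.
move=> fW hW; apply: (@dim_le_coords k W pos_set fW) => v h; apply/eqP/contraT => /hW.
rewrite hformE ltNge -oppr_ge0 -sumrN sumr_ge0// => i _; rewrite -mulNr.
have [ei|ei] := ltP 0 (eigval A i); last by rewrite mulr_ge0 ?sqn_ge0 ?oppr_ge0.
by rewrite h ?inE// /sqn/= expr0n addr0 mulr0.
Qed.

Lemma dim_le_null k (W : 'M[C]_(k, n)) : row_free W -> W *m A = 0 -> (k <= #|null_set|)%N.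
Proof.
move=> fW hW; apply: (@dim_le_coords k W null_set fW) => v h; apply: (@coords0 A).
have /mulmx_eq0_coords H : v *m W *m A = 0 by rewrite -mulmxA hW mulmx0.
apply/rowP => i; rewrite [RHS]mxE; have [ei|/H//] := eqVneq (eigval A i) 0.
by apply: h; rewrite inE ei.
Qed.

(** Spanned by the eigenvectors for the nonpositive eigenvalues. *)
Lemma npos_subspace : exists W : 'M[C]_(#|npos_set|, n), row_free W /\
  forall v : 'rV_(#|npos_set|), hform A (v *m W) <= 0.
Proof.
have [W [fW HW]] := spectral_subspace npos_set; exists W; split=> // v.
rewrite hformE -oppr_ge0 -sumrN sumr_ge0// => i _; rewrite -mulNr.
have [ei|ei] := leP (eigval A i) 0; first by rewrite mulr_ge0 ?sqn_ge0 ?oppr_ge0.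
by rewrite HW ?inE -?ltNge// /sqn/= expr0n addr0 mulr0.
Qed.

Lemma null_subspace : exists W : 'M[C]_(#|null_set|, n), row_free W /\ W *m A = 0.
Proof.
have [W [fW HW]] := spectral_subspace null_set; exists W; split=> //.
apply/row_matrixP => j; rewrite row_mul row0 rowE; apply/mulmx_eq0_coords => i ei.
by apply: HW; rewrite inE.
Qed.

(** The uniform constant [d] makes this estimate stable under small perturbations. *)
Lemma neg_subspace : exists (W : 'M[C]_(#|neg_set|, n)) (d : R), [/\ row_free W, 0 < d &
  forall v : 'rV_(#|neg_set|), hform A (v *m W) <= - d * nrm2 (v *m W)].
Proof.
have [W [fW HW]] := spectral_subspace neg_set.
exists W, (\big[Num.min/1]_(i | i \in neg_set) (- eigval A i)); split=> //.
  by elim/big_ind: _ => // [x y x0 y0|i]; rewrite ?lt_min ?x0// inE oppr_gt0.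
move=> v; rewrite hformE -(nrm2_coords A) /nrm2 mulr_sumr ler_sum// => i _.
have [ei|ei] := ltP (eigval A i) 0; last first.
  by rewrite HW ?inE -?leNgt// /sqn/= expr0n addr0 !mulr0.
rewrite ler_wpM2r ?sqn_ge0// lerNr.
by rewrite (bigD1 i) ?inE//= ge_min lexx.
Qed.

Lemma pos_subspace : exists (W : 'M[C]_(#|pos_set|, n)) (d : R), [/\ row_free W, 0 < d &
  forall v : 'rV_(#|pos_set|), d * nrm2 (v *m W) <= hform A (v *m W)].
Proof.
have [W [fW HW]] := spectral_subspace pos_set.
exists W, (\big[Num.min/1]_(i | i \in pos_set) (eigval A i)); split=> //.
  by elim/big_ind: _ => // [x y x0 y0|i]; rewrite ?lt_min ?x0// inE.
move=> v; rewrite hformE -(nrm2_coords A) /nrm2 mulr_sumr ler_sum// => i _.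
have [ei|ei] := ltP 0 (eigval A i); last first.
  by rewrite HW ?inE -?leNgt// /sqn/= expr0n addr0 !mulr0.
rewrite ler_wpM2r ?sqn_ge0//.
by rewrite (bigD1 i) ?inE//= ge_min lexx.
Qed.

Lemma card_npos : #|npos_set| = (#|neg_set| + #|null_set|)%N.
Proof.
rewrite -cardsUI (_ : (neg_set :&: null_set)%SET = finset.set0); last first.
  by apply/setP => i; rewrite !inE; case: ltgtP.
rewrite cards0 addn0; apply: eq_card => i; rewrite !inE le_eqVlt orbC.
by [].
Qed.

Lemma card_pos : (#|npos_set| + #|pos_set| = n)%N.
Proof.
rewrite -cardsUI (_ : (npos_set :&: pos_set)%SET = finset.set0); last first.
  by apply/setP => i; rewrite !inE; case: ltgtP.
rewrite cards0 addn0 -[RHS]card_ord -cardsT; apply: eq_card => i.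
by rewrite !inE; case: ltgtP.
Qed.

End Inertia.

(** * Eigenvalues crossing zero *)

Section Crossing.
Context {R : realType} {n : nat}.
Notation C := R[i].
Variables (Af : R -> 'M[C]_n) (lam : R).
Hypothesis lam0 : 0 <= lam.
Hypothesis hA : forall mu, Af mu \is hermsymmx.
Hypothesis decr : forall mu nu (x : 'rV[C]_n), mu < nu -> nu <= lam -> x != 0 ->
  hform (Af nu) x < hform (Af mu) x.
Hypothesis ge0 : forall x : 'rV[C]_n, 0 <= hform (Af 0) x.
Hypothesis cont : forall mu e, 0 <= mu <= lam -> 0 < e ->
  exists2 d, 0 < d & forall nu, 0 <= nu <= lam -> `|nu - mu| < d ->
    forall x : 'rV[C]_n, `|hform (Af nu) x - hform (Af mu) x| <= e * nrm2 x.

Definition ev_npos mu := #|npos_set (Af mu)|.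
Definition ev_neg mu := #|neg_set (Af mu)|.
Definition ev_null mu := #|null_set (Af mu)|.

(** A subspace where the form is nonpositive at mu is one where it is negative at nu. *)
Lemma npos_le_neg mu nu : mu < nu -> nu <= lam -> (ev_npos mu <= ev_neg nu)%N.
Proof.
move=> mn nl; have [W [fW HW]] := npos_subspace (hA mu).
apply: (dim_le_neg (hA nu) fW) => v v0.
exact: lt_le_trans (decr mn nl v0) (HW v).
Qed.

Lemma neg_le_npos mu : (ev_neg mu <= ev_npos mu)%N.
Proof. by rewrite /ev_npos card_npos leq_addr. Qed.

Lemma ev_neg_at0 : ev_neg 0 = 0%N.
Proof.
have [W [d [fW d0 HW]]] := neg_subspace (hA 0).
apply/eqP; rewrite -leqn0.
suff : (ev_neg 0 <= #|@finset.set0 'I_n|)%N by rewrite cards0.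
apply: (@dim_le_coords _ _ (Af 0) _ W finset.set0 fW) => v _.
apply/eqP; rewrite -nrm2_eq0 eq_le nrm2_ge0 andbT.
have := le_trans (ge0 _) (HW v).
by rewrite mulNr oppr_ge0 pmulr_rle0.
Qed.

(** Negative and positive subspaces survive small perturbations, so the numbers of negative
and of positive eigenvalues can only jump up. *)
Lemma semicontinuity mu : 0 <= mu <= lam ->
  exists2 d, 0 < d & forall nu, 0 <= nu <= lam -> `|nu - mu| < d ->
    (ev_npos nu <= ev_npos mu)%N /\ (ev_neg mu <= ev_neg nu)%N.
Proof.
move=> mul.
have [W [d [fW d0 HW]]] := neg_subspace (hA mu).
have [W' [d' [fW' d0' HW']]] := pos_subspace (hA mu).
have e0 : 0 < Num.min d d' / 2 by rewrite divr_gt0// lt_min d0.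
have [delta_pt dl0 Hd] := cont mul e0; exists delta_pt => // nu nul /(Hd nu nul) {}Hd.
have ed : Num.min d d' / 2 < d.
  have : Num.min d d' <= d by rewrite ge_min lexx.
  by lra.
have ed' : Num.min d d' / 2 < d'.
  have : Num.min d d' <= d' by rewrite ge_min lexx orbT.
  by lra.
split.
  have cp := card_pos (Af nu); have cm := card_pos (Af mu).
  suff : (#|pos_set (Af mu)| <= #|pos_set (Af nu)|)%N.
    by move=> pp; rewrite /ev_npos -(leq_add2r #|pos_set (Af nu)|) cp -[X in (X <= _)%N]cm leq_add2l.
  apply: (dim_le_pos (hA nu) fW') => v v0.
  have := Hd (v *m W'); have := HW' v; rewrite ler_distl => h1 /andP[h2 _].
  apply: lt_le_trans h2; rewrite subr_gt0; apply: lt_le_trans h1.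
  by rewrite ltr_pM2r// nrm2_gt0.
apply: (dim_le_neg (hA nu) fW) => v v0.
have := Hd (v *m W); have := HW v; rewrite ler_distl => h1 /andP[_ h2].
apply: le_lt_trans h2 _; rewrite -ltrBDr sub0r -mulNr.
by apply: le_lt_trans h1 _; rewrite ltr_pM2r ?nrm2_gt0// ltrN2.
Qed.

(** The eigenvalue of rank [j] in increasing order, counted from 0, vanishes at mu. *)
Definition crossed mu (j : nat) := (ev_neg mu <= j < ev_npos mu)%N.

(** The kernel at mu has as many dimensions as there are ranks that cross zero at mu. *)
Lemma ev_null_sum mu : ev_null mu = (\sum_(j < n) crossed mu j)%N.
Proof.
have pn : (ev_npos mu <= n)%N by rewrite -[X in (_ <= X)%N](card_pos (Af mu)) leq_addr.
have -> : ev_null mu = (ev_npos mu - ev_neg mu)%N.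
  by rewrite /ev_npos card_npos addKn.
rewrite -(big_mkord xpredT (fun j => (crossed mu j : nat))).
rewrite -[LHS]muln1 -sum_nat_const_nat (big_nat_widen _ _ _ _ _ pn).
rewrite (big_nat_widenl _ 0)// big_mkcond; apply: eq_bigr => j _.
by rewrite /crossed andbC; case: (_ && _).
Qed.

(** By strict monotonicity an eigenvalue of given rank vanishes only once. *)
Lemma crossed_inj mu nu j : mu <= lam -> nu <= lam -> crossed mu j -> crossed nu j ->
  mu = nu.
Proof.
wlog mn : mu nu / mu <= nu => [H|].
  by case: (leP mu nu) => [|/ltW] h *; [apply: H|apply/esym/H].
move: mn; rewrite le_eqVlt => /orP[/eqP//|mn] _ nl /andP[_ h1] /andP[h2 _].
by have := npos_le_neg mn nl; rewrite leqNgt (leq_ltn_trans h2 h1).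
Qed.

Lemma crossing_upper (s : seq R) : uniq s -> (forall mu, mu \in s -> mu <= lam) ->
  (\sum_(mu <- s) ev_null mu <= n)%N.
Proof.
move=> us sl; under eq_bigr do rewrite ev_null_sum.
rewrite exchange_big /= -[X in (_ <= X)%N]card_ord -sum1_card leq_sum// => j _.
elim: s us sl => [|mu s IH] /=; first by rewrite big_nil.
move=> /andP[mus us] sl; rewrite big_cons.
have [c|_] := boolP (crossed mu j); last first.
  by rewrite add0n IH// => nu nus; apply: sl; rewrite inE nus orbT.
rewrite big1_seq// => nu /andP[_ nus]; case: (boolP (crossed nu j)) => // c'.
suff nm : nu = mu by rewrite nm (negPf mus) in nus.
by apply: crossed_inj c' c; apply: sl; rewrite inE ?nus ?orbT ?eqxx.
Qed.

(** The infimum of the parameters where more than [j] eigenvalues are nonpositive: by right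
semicontinuity it belongs to that set, and by left semicontinuity at most [j] eigenvalues are
already negative there. *)
Lemma crossing_exists (j : nat) : (j < ev_npos lam)%N ->
  exists2 mu, 0 <= mu <= lam & crossed mu j.
Proof.
move=> jp; pose S := [set mu | 0 <= mu <= lam /\ (j < ev_npos mu)%N].
have Slam : S lam by split=> //; rewrite lam0 lexx.
have lbS : lbound S 0 by move=> mu [/andP[]].
have hS : has_inf S by split; [exists lam|exists 0].
have i0 : 0 <= inf S by apply: lb_le_inf => //; exists lam.
have il : inf S <= lam by apply: ge_inf => //; exists 0.
have il' : 0 <= inf S <= lam by rewrite i0.
have [d d0 Hd] := semicontinuity il'.
(* The value inf S = 0 is covered by the nonnegativity at 0; otherwise look slightly to the left. *)
exists (inf S) => //; apply/andP; split.
  have [e0|/eqP e0] := pselect (inf S = 0); first by rewrite e0 ev_neg_at0.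
  have i0' : 0 < inf S by rewrite lt_neqAle eq_sym e0.
  rewrite leqNgt; apply/negP => jq.
  (* A parameter of [0, lam] to the left of inf S and within d of it. *)
  pose nu := Num.max 0 (inf S - d / 2).
  have nul : nu < inf S by rewrite gt_max i0' ltrBlDr ltrDl divr_gt0.
  have nu0 : 0 <= nu by rewrite le_max lexx.
  have nulam : 0 <= nu <= lam by rewrite nu0 ltW// (lt_le_trans nul).
  have [|_ h] := Hd nu nulam.
    rewrite distrC ger0_norm ?subr_ge0 ?ltW//.
    have : inf S - d / 2 <= nu by rewrite le_max lexx orbT.
    by lra.
  suff : inf S <= nu by rewrite leNgt nul.
  apply: ge_inf; first by exists 0.
  split=> //; exact: leq_trans jq (leq_trans h (neg_le_npos nu)).
rewrite ltnNge; apply/negP => pj.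
have [nu [/andP[n0 nl] jn] nd] := inf_adherent d0 hS.
have inu : inf S <= nu by apply: ge_inf; [exists 0|split; rewrite ?n0].
have [||h _] := Hd nu; first by rewrite n0.
  by rewrite ger0_norm ?subr_ge0// ltrBlDl.
by have := leq_trans jn (leq_trans h pj); rewrite ltnn.
Qed.

Lemma crossing_lower : exists s : seq R, [/\ uniq s,
  forall mu, mu \in s -> 0 <= mu <= lam & (ev_npos lam <= \sum_(mu <- s) ev_null mu)%N].
Proof.
have /choice [m Hm] : forall j : 'I_n, exists mu, (j < ev_npos lam)%N ->
    0 <= mu <= lam /\ crossed mu j.
  move=> j; case: (ltnP j (ev_npos lam)) => [/crossing_exists [mu]|_]; last by exists 0.
  by exists mu.
pose s0 := [seq m j | j : 'I_n <- enum 'I_n & (j < ev_npos lam)%N].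
exists (undup s0); split; first exact: undup_uniq.
  move=> mu; rewrite mem_undup => /mapP[j]; rewrite mem_filter => /andP[jp _] ->.
  by have [] := Hm j jp.
under eq_bigr do rewrite ev_null_sum.
rewrite exchange_big /=.
have pn : (ev_npos lam <= n)%N.
  by rewrite -[X in (_ <= X)%N](card_pos (Af lam)) leq_addr.
have {1}-> : ev_npos lam = (\sum_(j < n) (j < ev_npos lam))%N.
  rewrite -(big_mkord xpredT (fun j => ((j < ev_npos lam)%N : nat))).
  rewrite -[LHS]muln1 -[X in (X * _)%N]subn0 -sum_nat_const_nat.
  rewrite (big_nat_widen _ _ _ _ _ pn) big_mkcond; apply: eq_bigr => j _.
  by case: (_ < _)%N.
apply: leq_sum => j _; case: ltnP => // jp; have [_ jc] := Hm j jp.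
have ms : m j \in undup s0.
  by rewrite mem_undup; apply/mapP; exists j; rewrite // mem_filter jp mem_enum.
by rewrite (bigD1_seq (m j)) ?undup_uniq//= jc leq_addr.
Qed.

End Crossing.

(** * The matrix of a subdivided graph *)

Section RankOne.
Context {R : realType} {n : nat}.
Notation C := R[i].
Implicit Types (A B : 'M[C]_n) (x w : 'rV[C]_n) (c : R).

Definition rank1 w : 'M[C]_n := w^T *m w.

Lemma hformD A B x : hform (A + B) x = hform A x + hform B x.
Proof. by rewrite /hform mulmxDr mulmxDl mxE cReD. Qed.

Lemma hform0 x : hform 0 x = 0.
Proof. by rewrite /hform mulmx0 mul0mx mxE. Qed.

Lemma hformZ c A x : hform (c%:C%C *: A) x = c * hform A x.
Proof. by rewrite /hform -scalemxAr -scalemxAl [X in complex.Re X]mxE cReMl. Qed.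

Lemma hform_sum (I : Type) (r : seq I) (F : I -> 'M[C]_n) x :
  hform (\sum_(i <- r) F i) x = \sum_(i <- r) hform (F i) x.
Proof. by elim/big_rec2: _ => [|i a b _ <-]; rewrite ?hform0 ?hformD. Qed.

(** For a real vector [w] the form of [w^T w] is the squared modulus of a linear functional. *)
Lemma hform_rank1 w x : w ^ Num.conj = w -> hform (rank1 w) x = sqn ((x *m w^T) 0 0).
Proof.
move=> rw; rewrite /hform /rank1.
have -> : x *m (w^T *m w) *m x^t* = (x *m w^T) *m (x *m w^T)^t*.
  by rewrite trmx_mul map_mxM trmxK rw !mulmxA.
by move: (x *m w^T) => z; rewrite mxE big_ord1 !mxE mulC_conj.
Qed.

Definition herm A := A^t* = A.

Lemma herm_hermsymmx A : herm A -> A \is hermsymmx.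
Proof. by move=> h; apply/is_hermitianmxP; rewrite expr0 scale1r h. Qed.

Lemma hermD A B : herm A -> herm B -> herm (A + B).
Proof. by rewrite /herm linearD map_mxD /= => -> ->. Qed.

Lemma herm0 : herm 0.
Proof. by rewrite /herm trmx0 map_mx0. Qed.

Lemma hermZ c A : herm A -> herm (c%:C%C *: A).
Proof.
rewrite /herm => h; apply/matrixP => i j; rewrite !mxE rmorphM /=.
have -> : (c%:C%C : C)^* = c%:C%C by apply: complex_eqP; rewrite //= oppr0.
by congr (_ * _); have /matrixP/(_ i j) := h; rewrite !mxE.
Qed.

Lemma herm_rank1 w : w ^ Num.conj = w -> herm (rank1 w).
Proof. by move=> rw; rewrite /herm /rank1 trmx_mul map_mxM trmxK -map_trmx rw. Qed.

Lemma herm_sum (I : Type) (r : seq I) (F : I -> 'M[C]_n) :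
  (forall i, herm (F i)) -> herm (\sum_(i <- r) F i).
Proof. by move=> h; elim/big_ind: _ => //; [exact: herm0|exact: hermD]. Qed.

End RankOne.

Section Subdivision.
Context {R : realType} (G : metric_graph R) (k : edge G -> nat).
Notation C := R[i].
Notation V := (vertex G).
Notation E := (edge G).
Implicit Types (mu nu : R) (e : E) (v : V).

Definition point : finType := (V + {e : E & 'I_(k e)})%type.
Definition inner e (i : 'I_(k e)) : point := inr (Tagged (fun e => 'I_(k e)) i).
(** The point of rank [j] on [e], for [0 <= j <= k e + 1]; the extreme ranks are the vertices of
[e], and any larger rank also gives the terminal vertex. *)
Definition pt e (j : nat) : point :=
  if j is j'.+1 then
    if insub j' is Some i then inner (i : 'I_(k e)) else inl (ter e)
  else inl (ini e).
Definition piece e : R := len e / (k e).+1%:R.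

Lemma pt0 e : pt e 0 = inl (ini e). Proof. by []. Qed.

Lemma pt_inner e (i : 'I_(k e)) : pt e i.+1 = inner i.
Proof. by rewrite /pt valK. Qed.

Lemma pt_last e : pt e (k e).+1 = inl (ter e).
Proof. by rewrite /pt insubF// ltnn. Qed.

Lemma piece_gt0 e : 0 < piece e.
Proof. by rewrite divr_gt0 ?len_gt0. Qed.

Lemma piece_len e : (k e).+1%:R * piece e = len e.
Proof. by rewrite mulrC divfK// pnatr_eq0. Qed.

Definition at_pt (y : 'rV[C]_#|point|) (t : point) : C := y 0 (enum_rank t).

Definition delta_pt (t : point) : 'rV[C]_#|point| := delta_mx 0 (enum_rank t).

Lemma mul_delta_pt y t : (y *m (delta_pt t)^T) 0 0 = at_pt y t.
Proof.
rewrite mxE (bigD1 (enum_rank t))//= !mxE !eqxx mulr1 big1 ?addr0// => j jt.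
by rewrite !mxE eqxx (negPf jt) mulr0.
Qed.

Lemma mul_delta_ptB y s t : (y *m (delta_pt s - delta_pt t)^T) 0 0 = at_pt y s - at_pt y t.
Proof. by rewrite linearB mulmxBr [LHS]mxE [X in _ + X = _]mxE !mul_delta_pt. Qed.

Lemma mul_delta_ptD y s t : (y *m (delta_pt s + delta_pt t)^T) 0 0 = at_pt y s + at_pt y t.
Proof. by rewrite linearD mulmxDr [LHS]mxE !mul_delta_pt. Qed.

Lemma delta_pt_real t : (delta_pt t) ^ Num.conj = delta_pt t.
Proof. by apply/matrixP => i j; rewrite !mxE; case: (_ && _); rewrite ?rmorph1 ?rmorph0. Qed.

(** The energy of the solution on the piece number [j] of [e]. *)
Definition piece_mx mu e (j : nat) : 'M[C]_#|point| :=
  (qdiff mu (piece e) / 2)%:C%C *: rank1 (delta_pt (pt e j) - delta_pt (pt e j.+1)) +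
  (- (qsum mu (piece e) / 2))%:C%C *: rank1 (delta_pt (pt e j) + delta_pt (pt e j.+1)).

(** The last term is minus the Dirichlet energy of the affine interpolant of the vertex values; it
encodes the vertex condition of the Krein extension. At interior points the matrix encodes
continuity of the derivative. *)
Definition krein_mx mu : 'M[C]_#|point| := \sum_(e : E)
  (\sum_(j < (k e).+1) piece_mx mu e j +
   (- (len e)^-1)%:C%C *: rank1 (delta_pt (inl (ter e)) - delta_pt (inl (ini e)))).

Lemma krein_mx_herm mu : krein_mx mu \is hermsymmx.
Proof.
have dB s t : (delta_pt s - delta_pt t) ^ Num.conj = delta_pt s - delta_pt t.
  by rewrite map_mxB !delta_pt_real.
have dD s t : (delta_pt s + delta_pt t) ^ Num.conj = delta_pt s + delta_pt t.
  by rewrite map_mxD !delta_pt_real.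
apply/herm_hermsymmx/herm_sum => e; apply: hermD; last exact/hermZ/herm_rank1.
by apply: herm_sum => j; apply: hermD; apply/hermZ/herm_rank1.
Qed.

Lemma hform_piece mu e j y : hform (piece_mx mu e j) y =
  qdiff mu (piece e) / 2 * sqn (at_pt y (pt e j) - at_pt y (pt e j.+1)) -
  qsum mu (piece e) / 2 * sqn (at_pt y (pt e j) + at_pt y (pt e j.+1)).
Proof.
rewrite hformD !hformZ !hform_rank1 ?map_mxB ?map_mxD ?delta_pt_real//.
by rewrite mul_delta_ptB mul_delta_ptD mulNr.
Qed.

End Subdivision.

(** * Monotonicity and positivity of the matrix *)

Lemma cauchy_sum (R : realType) (m : nat) (a : nat -> R) :
  (\sum_(j < m) a j) ^+ 2 <= m%:R * \sum_(j < m) a j ^+ 2.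
Proof.
case: m => [|m]; first by rewrite !big_ord0 expr0n mul0r.
set S := \sum_(j < m.+1) a j; set Q := \sum_(j < m.+1) a j ^+ 2.
have m0 : 0 < m.+1%:R :> R by rewrite ltr0n.
(* The variance of the a j about their mean is nonnegative. *)
pose t := S / m.+1%:R.
have : 0 <= \sum_(j < m.+1) (a j - t) ^+ 2 by apply: sumr_ge0 => j _; exact: sqr_ge0.
have -> : \sum_(j < m.+1) (a j - t) ^+ 2 = Q - S ^+ 2 / m.+1%:R.
  have E (j : 'I_m.+1) : true -> (a j - t) ^+ 2 = a j ^+ 2 + (- 2 * t * a j + t ^+ 2) by move=> _; ring.
  rewrite (eq_bigr _ E) !big_split /= -mulr_sumr sumr_const card_ord -/S -/Q /t.
  rewrite -[X in _ + (_ + X)]mulr_natr; field; by rewrite addrC natr1 gt_eqF.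
by rewrite subr_ge0 ler_pdivrMr// mulrC.
Qed.

Section FormProperties.
Context {R : realType} (G : metric_graph R) (k : edge G -> nat).
Notation C := R[i].
Notation V := (vertex G).
Notation E := (edge G).
Notation y_ y e j := (at_pt y (pt k e j)).
Implicit Types (mu nu : R) (e : E) (v : V) (y : 'rV[C]_#|point k|).

Lemma hform_krein_mx mu y : hform (krein_mx k mu) y =
  \sum_(e : E) (\sum_(j < (k e).+1)
    (qdiff mu (piece k e) / 2 * sqn (y_ y e j - y_ y e j.+1) -
     qsum mu (piece k e) / 2 * sqn (y_ y e j + y_ y e j.+1)) -
    (len e)^-1 * sqn (y_ y e (k e).+1 - y_ y e 0)).
Proof.
rewrite hform_sum; apply: eq_bigr => e _; rewrite hformD hform_sum.
congr (_ + _); first by apply: eq_bigr => j _; rewrite hform_piece.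
by rewrite hformZ hform_rank1 ?map_mxB ?delta_pt_real// mul_delta_ptB mulNr pt_last.
Qed.

Lemma hform_krein_mxB mu nu y : hform (krein_mx k mu) y - hform (krein_mx k nu) y =
  \sum_(e : E) \sum_(j < (k e).+1)
    ((qdiff mu (piece k e) - qdiff nu (piece k e)) / 2 * sqn (y_ y e j - y_ y e j.+1) +
     (qsum nu (piece k e) - qsum mu (piece k e)) / 2 * sqn (y_ y e j + y_ y e j.+1)).
Proof.
rewrite (hform_krein_mx mu) (hform_krein_mx nu) -[LHS]sumrB; apply: eq_bigr => e _.
have E3 (a b c : R) : (a - c) - (b - c) = a - b by ring.
by rewrite E3 -sumrB; apply: eq_bigr => j _; ring.
Qed.

Hypothesis Gconn : connected_graph G.

(** This is where connectedness enters: the values at an isolated vertex would be invisible to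
the form. *)
Lemma vertex_incident v : exists e, ini e = v \/ ter e = v.
Proof.
have /card_gt0P [e _] := edge_nonempty G.
have /connectP [p] := Gconn v (ini e).
case: p => [_ /= ev|w p /=]; first by exists e; left.
move=> /andP[/existsP [e' /orP[/andP[/eqP h _]|/andP[_ /eqP h]]] _] _; exists e'.
  by left.
by right.
Qed.

Lemma point_incident (t : point k) : exists e, exists j : 'I_(k e).+1,
  t = pt k e j \/ t = pt k e j.+1.
Proof.
case: t => [v|[e i]].
  have [e [<-|<-]] := vertex_incident v.
    by exists e, ord0; left.
  by exists e, ord_max; right; rewrite pt_last.
have ik : (i < (k e).+1)%N by rewrite ltnS ltnW.
by exists e, (Ordinal ik); right; rewrite pt_inner.
Qed.

Lemma sqn_parallelogram (z w : C) : sqn (z - w) + sqn (z + w) = 2 * (sqn z + sqn w).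
Proof. by case: z => a b; case: w => c d; rewrite /sqn /=; ring. Qed.

Variable lam : R.
Hypothesis adm : forall e, Num.sqrt lam * piece k e < pi.

Lemma hform_krein_mx_decr mu nu y : mu < nu -> nu <= lam -> y != 0 ->
  hform (krein_mx k nu) y < hform (krein_mx k mu) y.
Proof.
move=> mn nl y0; rewrite -subr_gt0 hform_krein_mxB.
have admn e : Num.sqrt nu * piece k e < pi.
  by apply: sqrt_mul_lt nl _ (adm e); rewrite ltW ?piece_gt0.
have Hd e : 0 < (qdiff mu (piece k e) - qdiff nu (piece k e)) / 2.
  by rewrite divr_gt0// subr_gt0 qdiff_decr ?piece_gt0.
have Hs e : 0 < (qsum nu (piece k e) - qsum mu (piece k e)) / 2.
  by rewrite divr_gt0// subr_gt0 qsum_incr ?piece_gt0.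
set D := BIG_F.
have T0 e (j : 'I_(k e).+1) : true ->
    0 <= (qdiff mu (piece k e) - qdiff nu (piece k e)) / 2 * sqn (y_ y e j - y_ y e j.+1) +
     (qsum nu (piece k e) - qsum mu (piece k e)) / 2 * sqn (y_ y e j + y_ y e j.+1).
  by move=> _; rewrite addr_ge0// mulr_ge0 ?sqn_ge0 ?ltW.
have D0 e : true -> 0 <= D e by move=> _; apply: sumr_ge0 => j; exact: T0.
rewrite lt_neqAle sumr_ge0 ?andbT//.
rewrite eq_sym; apply: contra y0 => /eqP h; apply/eqP/rowP => i; rewrite mxE.
have z0 e (j : 'I_(k e).+1) : y_ y e j = 0 /\ y_ y e j.+1 = 0.
  have De0 := psumr_eq0P D0 h (i := e) isT.
  have /eqP := psumr_eq0P (@T0 e) De0 (i := j) isT.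
  rewrite (paddr_eq0 (mulr_ge0 (ltW (Hd e)) (sqn_ge0 _)) (mulr_ge0 (ltW (Hs e)) (sqn_ge0 _))).
  rewrite mulf_eq0 (gt_eqF (Hd e)) mulf_eq0 (gt_eqF (Hs e)) /= => /andP[/eqP a1 /eqP a2].
  have := sqn_parallelogram (y_ y e j) (y_ y e j.+1); rewrite a1 a2 addr0 => /esym/eqP.
  by rewrite mulf_eq0 pnatr_eq0/= paddr_eq0 ?sqn_ge0// !sqn_eq0 => /andP[/eqP-> /eqP->].
have [e [j]] := point_incident (enum_val i).
have [h1 h2] := z0 e j; move=> it; rewrite -(enum_valK i) -/(at_pt y _).
by case: it => ->.
Qed.

(** For mu = 0 both energies are Dirichlet energies, of the piecewise affine and of the edgewise
affine interpolant, and the latter minimizes the energy for the given vertex values; on an edge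
this is the Cauchy-Schwarz inequality. *)
Lemma hform_krein_mx0_ge0 y : 0 <= hform (krein_mx k 0) y.
Proof.
rewrite hform_krein_mx; apply: sumr_ge0 => e _; rewrite subr_ge0 qsum0 qdiff0 mul0r.
under eq_bigr do rewrite mul0r subr0.
have l0 := len_gt0 e; have k0 : 0 < (k e).+1%:R :> R by rewrite ltr0n.
rewrite -mulr_sumr mulrC ler_pdivrMr//.
have -> : 2 / piece k e / 2 * (\sum_(j < (k e).+1) sqn (y_ y e j - y_ y e j.+1)) * len e =
  (k e).+1%:R * \sum_(j < (k e).+1) sqn (y_ y e j - y_ y e j.+1).
  have p0 := piece_gt0 k e; rewrite -(piece_len k e); field; by rewrite gt_eqF.
have tel : y_ y e 0 - y_ y e (k e).+1 = \sum_(j < (k e).+1) (y_ y e j - y_ y e j.+1).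
  elim: (k e).+1 => [|m IH]; first by rewrite big_ord0 subrr.
  by rewrite big_ord_recr /= -IH addrA subrK.
rewrite /sqn big_split /= mulrDr lerD//.
- rewrite -sqrrN -cReN opprB tel.
  rewrite (big_morph _ cReD (erefl (complex.Re 0))).
  exact: (cauchy_sum _ (fun j => complex.Re (y_ y e j - y_ y e j.+1))).
- rewrite -sqrrN -cImN opprB tel.
  rewrite (big_morph _ cImD (erefl (complex.Im 0))).
  exact: (cauchy_sum _ (fun j => complex.Im (y_ y e j - y_ y e j.+1))).
Qed.

End FormProperties.

(** * Continuity of the matrix *)

Lemma cvg_bigsum (R : realType) (I : Type) (r : seq I) (f : I -> R -> R)
    (a : I -> R) (x : R) :
  (forall i, f i t @[t --> x] --> a i) ->
  \sum_(i <- r) f i t @[t --> x] --> \sum_(i <- r) a i.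
Proof.
move=> fa; elim: r => [|i r IH].
  by under eq_fun do rewrite big_nil; rewrite big_nil; exact: cvg_cst.
by under eq_fun do rewrite big_cons; rewrite big_cons; exact: cvgD.
Qed.

Section Continuity.
Context {R : realType} (G : metric_graph R) (k : edge G -> nat).
Notation C := R[i].
Notation V := (vertex G).
Notation E := (edge G).
Notation y_ y e j := (at_pt y (pt k e j)).
Implicit Types (mu nu : R) (e : E) (v : V) (y : 'rV[C]_#|point k|).

Variable lam : R.
Hypothesis adm : forall e, Num.sqrt lam * piece k e < pi.

Lemma coef_continuous e : exists fd fs : R -> R, forall mu, 0 <= mu <= lam ->
  [/\ {for mu, continuous fd}, {for mu, continuous fs},
    fd mu = qdiff mu (piece k e) & fs mu = qsum mu (piece k e)].
Proof.
have [f cf fE] := cosl_cont (piece k e); have [g cg gE] := sinl_cont (piece k e).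
exists (fun nu => (f nu + 1) / g nu), (fun nu => (1 - f nu) / g nu).
move=> mu /andP[mu0 mul].
have g0 : g mu != 0.
  rewrite -gE// gt_eqF// sinl_gt0 ?piece_gt0//.
  by apply: sqrt_mul_lt mul _ (adm e); rewrite ltW ?piece_gt0.
have ci : {for mu, continuous (fun nu => (g nu)^-1)}.
  by apply: cvgV => //; exact: cg.
split; rewrite /qdiff /qsum ?fE ?gE//.
- by apply: cvgM => //; apply: cvgD; [exact: cf|exact: cvg_cst].
- by apply: cvgM => //; apply: cvgB; [exact: cvg_cst|exact: cf].
Qed.

Lemma sqn_sub_le (z w : C) : sqn (z - w) <= 2 * (sqn z + sqn w).
Proof. by rewrite -sqn_parallelogram lerDl sqn_ge0. Qed.

Lemma sqn_add_le (z w : C) : sqn (z + w) <= 2 * (sqn z + sqn w).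
Proof. by rewrite -sqn_parallelogram lerDr sqn_ge0. Qed.

Lemma sqn_at_pt_le y t : sqn (at_pt y t) <= nrm2 y.
Proof.
rewrite /nrm2 (bigD1 (enum_rank t))//= lerDl sumr_ge0// => i _; exact: sqn_ge0.
Qed.

Lemma hform_krein_mx_cont mu eps : 0 <= mu <= lam -> 0 < eps ->
  exists2 d, 0 < d & forall nu, 0 <= nu <= lam -> `|nu - mu| < d ->
    forall y, `|hform (krein_mx k nu) y - hform (krein_mx k mu) y| <= eps * nrm2 y.
Proof.
move=> mul eps0; have /choice [fd /choice [fs Hf]] := coef_continuous.
(* K bounds the variation of the form, since |z - w|^2 and |z + w|^2 are at most 2 (|z|^2 + |w|^2). *)
pose K nu := \sum_(e : E) (k e).+1%:R * 2 * (`|fd e nu - fd e mu| + `|fs e nu - fs e mu|).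
have cK : K nu @[nu --> mu] --> (0 : R).
  have -> : (0 : R) = \sum_(e : E) (k e).+1%:R * 2 * (`|fd e mu - fd e mu| + `|fs e mu - fs e mu|).
    by rewrite big1// => e _; rewrite !subrr normr0 addr0 mulr0.
  apply: cvg_bigsum => e; have [h1 h2 _ _] := Hf e mu mul.
  apply: cvgM; first exact: cvg_cst.
  by apply: cvgD; apply: cvg_norm; apply: cvgB => //; exact: cvg_cst.
have /cvgrPdist_lt /(_ eps eps0) /nbhs_ballP [d /= d0 Hd] := cK.
exists d => // nu nul nud y.
have {Hd} Kn : K nu < eps.
  have := Hd nu; rewrite /ball/= distrC => /(_ nud).
  by rewrite sub0r normrN; apply: le_lt_trans; exact: ler_norm.
apply: (@le_trans _ _ (K nu * nrm2 y)); last by rewrite ler_wpM2r ?nrm2_ge0 ?ltW.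
rewrite hform_krein_mxB /K mulr_suml; apply: le_trans (ler_norm_sum _ _ _) _.
apply: ler_sum => e _; apply: le_trans (ler_norm_sum _ _ _) _.
have [_ _ <- <-] := Hf e nu nul; have [_ _ <- <-] := Hf e mu mul.
set a := fd e nu; set b := fd e mu; set c := fs e nu; set c' := fs e mu.
have -> : (k e).+1%:R * 2 * (`|a - b| + `|c - c'|) * nrm2 y =
    \sum_(j < (k e).+1) (2 * (`|a - b| + `|c - c'|) * nrm2 y).
  by rewrite sumr_const card_ord -[RHS]mulr_natl; ring.
apply: ler_sum => j _.
have s1 := sqn_at_pt_le y (pt k e j); have s2 := sqn_at_pt_le y (pt k e j.+1).
have p1 := sqn_sub_le (y_ y e j) (y_ y e j.+1).
have p2 := sqn_add_le (y_ y e j) (y_ y e j.+1).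
apply: le_trans (ler_normD _ _) _; rewrite !normrM !(ger0_norm (sqn_ge0 _)).
rewrite normfV (ger0_norm (ler0n _ 2)) [`|c' - c|]distrC.
have := normr_ge0 (a - b); have := normr_ge0 (c - c').
move: (`|a - b|) (`|c - c'|) => A B B0 A0.
have := sqn_ge0 (y_ y e j - y_ y e j.+1); have := sqn_ge0 (y_ y e j + y_ y e j.+1).
nra.
Qed.

End Continuity.

(** * The kernel of the matrix *)

Arguments pt : simpl never.

Section Kernel.
Context {R : realType} (G : metric_graph R) (k : edge G -> nat).
Notation C := R[i].
Notation V := (vertex G).
Notation E := (edge G).
Notation y_ y e j := (at_pt y (pt k e j)).
Notation leb := (@lebesgue_measure R).
Variable mu : R.
Hypothesis adm : forall e, Num.sqrt mu * piece k e < pi.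
Implicit Types (e : E) (v : V) (y : 'rV[C]_#|point k|) (a : V -> C) (B : E -> C).

Notation cp e := ((cosl mu (piece k e))%:C%C).
Notation sp e := ((sinl mu (piece k e))%:C%C).

Lemma sp_neq0 e : sp e != 0.
Proof.
by rewrite eq_complex /= eqxx andbT gt_eqF// sinl_gt0 ?piece_gt0.
Qed.

(** For a sampled solution [outflow] is minus the derivative at the left end of the piece [j], and
[inflow] the derivative at its right end ([csol_out], [csol_in]). *)
Definition outflow y e j : C := (cp e * y_ y e j - y_ y e j.+1) / sp e.
Definition inflow y e j : C := (cp e * y_ y e j.+1 - y_ y e j) / sp e.

Lemma at_ptD y z t : at_pt (y + z) t = at_pt y t + at_pt z t.
Proof. by rewrite /at_pt mxE. Qed.

Lemma at_ptZ c y t : at_pt (c *: y) t = c * at_pt y t.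
Proof. by rewrite /at_pt mxE. Qed.

Lemma at_pt_sum (I : Type) (r : seq I) (F : I -> 'rV[C]_#|point k|) t :
  at_pt (\sum_(i <- r) F i) t = \sum_(i <- r) at_pt (F i) t.
Proof. by rewrite /at_pt summxE. Qed.

Lemma at_delta_pt (s t : point k) : at_pt (delta_pt s) t = (s == t)%:R.
Proof. by rewrite /at_pt /delta_pt mxE eqxx (inj_eq enum_rank_inj) eq_sym. Qed.

Lemma at_rank1 y w t : at_pt (y *m rank1 w) t = (y *m w^T) 0 0 * at_pt w t.
Proof. by rewrite /rank1 mulmxA {1}/at_pt mxE big_ord1. Qed.

Lemma at_delta_ptB (s t u : point k) : at_pt (delta_pt s - delta_pt t) u = (s == u)%:R - (t == u)%:R.
Proof. by rewrite -[- delta_pt t]scaleN1r at_ptD at_ptZ !at_delta_pt mulN1r. Qed.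

Lemma at_delta_ptD (s t u : point k) : at_pt (delta_pt s + delta_pt t) u = (s == u)%:R + (t == u)%:R.
Proof. by rewrite at_ptD !at_delta_pt. Qed.

Lemma at_mul_krein_mx y t : at_pt (y *m krein_mx k mu) t =
  \sum_(e : E) (\sum_(j < (k e).+1) (outflow y e j * (pt k e j == t)%:R) +
    \sum_(j < (k e).+1) (inflow y e j * (pt k e j.+1 == t)%:R) -
    slope (fun v => at_pt y (inl v)) e *
      ((inl (ter e) == t)%:R - (inl (ini e) == t)%:R)).
Proof.
rewrite /krein_mx mulmx_sumr at_pt_sum; apply: eq_bigr => e _.
rewrite mulmxDr at_ptD; congr (_ + _); last first.
  rewrite -scalemxAr at_ptZ at_rank1 mul_delta_ptB at_delta_ptB /slope rmorphN /= fmorphV.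
  ring.
rewrite mulmx_sumr at_pt_sum -big_split /=; apply: eq_bigr => j _.
rewrite mulmxDr at_ptD -!scalemxAr !at_ptZ !at_rank1 mul_delta_ptB mul_delta_ptD at_delta_ptB at_delta_ptD.
rewrite /outflow /inflow /qdiff /qsum.
move: (y_ y e j) (y_ y e j.+1) (_ == _)%:R (_ == _)%:R => y0 y1 d0 d1.
rewrite !(rmorphN, rmorphM, rmorphD, rmorphB, fmorphV, rmorph1) /=.
have := sp_neq0 e; move: (cp e) (sp e) => c s s0; field.
by rewrite s0.
Qed.

(** The row of a vertex of the equation is the vertex condition. *)
Lemma at_mul_krein_mx_vertex y v : at_pt (y *m krein_mx k mu) (inl v) =
  \sum_(e : E | ter e == v) (inflow y e (k e) - slope (fun v => at_pt y (inl v)) e) -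
  \sum_(e : E | ini e == v) (- outflow y e 0 - slope (fun v => at_pt y (inl v)) e).
Proof.
rewrite at_mul_krein_mx [X in X - _]big_mkcond [X in _ - X]big_mkcond /= -sumrB.
apply: eq_bigr => e _.
rewrite big_ord_recl [X in _ + X - _]big_ord_recr.
rewrite [X in _ + X + _ - _]big1; last first.
  by move=> i _; rewrite lift0 pt_inner mulr0.
rewrite [X in _ + (X + _) - _]big1; last first.
  by move=> i _; rewrite [pt k e _](pt_inner i) mulr0.
rewrite pt_last pt0 add0r addr0.
have inlE (u w : V) : ((inl u : point k) == inl w) = (u == w) by [].
rewrite !inlE; case: (ter e == v); case: (ini e == v). all: rewrite /=; ring.
Qed.

Lemma pt_eq_inner e' e (i : 'I_(k e)) (j : nat) :
  (pt k e' j == inner i) = (e' == e) && (j == i.+1).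
Proof.
case: j => [|j]; first by rewrite andbF.
rewrite eqSS /pt; case: insubP => [i' _ <-|jk].
  case: (eqVneq e' e) => [E|ne] /=.
    case: _ / E i => i.
    rewrite -[LHS]/(Tagged (fun e => 'I_(k e)) i' == Tagged (fun e => 'I_(k e)) i).
    by rewrite eq_Tagged.
  by apply/eqP => -[] /eqP; rewrite (negPf ne).
case: (eqVneq e' e) => //= E; case: _ / E i => i.
by apply/esym/negbTE; apply: contraNneq jk => ->.
Qed.

(** The row of a cut point says that the derivatives on both sides agree. *)
Lemma at_mul_krein_mx_inner y e (i : 'I_(k e)) :
  at_pt (y *m krein_mx k mu) (inner i) = outflow y e i.+1 + inflow y e i.
Proof.
rewrite at_mul_krein_mx (bigD1 e)//= [X in _ + X]big1 => [|e' /negPf e'e]; last first.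
  rewrite subr0 mulr0 subr0 !big1 ?addr0// => j _;
  by rewrite pt_eq_inner e'e mulr0.
rewrite addr0 subr0 mulr0 subr0; congr (_ + _).
  have ik : (i.+1 < (k e).+1)%N by rewrite ltnS.
  rewrite (bigD1 (Ordinal ik))//= pt_eq_inner !eqxx mulr1 big1 ?addr0// => j ji.
  rewrite pt_eq_inner eqxx/= (_ : (_ == _) = false) ?mulr0//.
  by apply: contraNF ji => /eqP ji; apply/eqP/val_inj.
have ik : (i < (k e).+1)%N by rewrite ltnS ltnW.
rewrite (bigD1 (Ordinal ik))//= pt_eq_inner !eqxx mulr1 big1 ?addr0// => j ji.
rewrite pt_eq_inner eqxx/= eqSS (_ : (_ == _) = false) ?mulr0//.
by apply: contraNF ji => /eqP ji; apply/eqP/val_inj.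
Qed.

Lemma csol_add (A B : C) (x h : R) :
  csol mu A B (x + h) = (cosl mu h)%:C%C * csol mu A B x +
     (sinl mu h)%:C%C * csol mu B (- mu%:C%C * A) x.
Proof.
rewrite /csol coslD sinlD !(rmorphM, rmorphD, rmorphB) /=; ring.
Qed.

Definition node e (j : nat) : R := j%:R * piece k e.

Lemma nodeS e j : node e j.+1 = node e j + piece k e.
Proof. by rewrite /node -natr1 mulrDl mul1r. Qed.

Lemma node_last e : node e (k e).+1 = len e.
Proof. exact: piece_len. Qed.

Lemma csol_out (A B : C) e j : (cp e * csol mu A B (node e j) - csol mu A B (node e j.+1)) / sp e =
  - csol mu B (- mu%:C%C * A) (node e j).
Proof.
by rewrite nodeS csol_add; field; exact: sp_neq0.
Qed.

Lemma csol_in (A B : C) e j : (cp e * csol mu A B (node e j.+1) - csol mu A B (node e j)) / sp e =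
  csol mu B (- mu%:C%C * A) (node e j.+1).
Proof.
have -> : node e j = node e j.+1 - piece k e by rewrite nodeS addrK.
by rewrite csol_add coslN sinlN rmorphN /=; field; exact: sp_neq0.
Qed.

Definition sample_at a B (t : point k) : C :=
  match t with
  | inl v => a v
  | inr t => csol mu (a (ini (tag t))) (B (tag t)) (node (tag t) (tagged t).+1)
  end.

Definition sample a B : 'rV[C]_#|point k| := \row_i sample_at a B (enum_val i).

Lemma at_sample a B e j : (forall e, csol mu (a (ini e)) (B e) (len e) = a (ter e)) ->
  (j <= (k e).+1)%N ->
  y_ (sample a B) e j = csol mu (a (ini e)) (B e) (node e j).
Proof.
move=> TE; rewrite /at_pt mxE enum_rankK; case: j => [|j] jk.
  by rewrite /node mul0r csol0.
rewrite /pt; case: insubP => [i _ <- //|].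
rewrite -leqNgt => kj; have -> : j = k e by apply/eqP; rewrite eqn_leq kj andbT -ltnS.
by rewrite node_last TE.
Qed.

Lemma sample_ker a B : Krein_data mu a B -> sample a B *m krein_mx k mu = 0.
Proof.
move=> [TE KE]; apply/rowP => i; rewrite -(enum_valK i) -/(at_pt _ _) [RHS]mxE.
have av v : at_pt (sample a B) (inl v) = a v by rewrite /at_pt mxE enum_rankK.
case: (enum_val i) => [v|[e j]].
  rewrite at_mul_krein_mx_vertex -[RHS](KE v); congr (_ - _); apply: eq_bigr => e _.
    rewrite /inflow !at_sample// csol_in node_last /slope !av//.
  by rewrite /outflow !at_sample// csol_out opprK /node mul0r csol0 /slope !av.
rewrite -/(inner j) at_mul_krein_mx_inner /outflow /inflow.
have jk := ltn_ord j.
rewrite (at_sample (j := j.+2) TE); last by lia.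
rewrite (at_sample (j := j.+1) TE); last by lia.
rewrite (at_sample (j := j) TE); last by lia.
by rewrite csol_out csol_in addNr.
Qed.

(** The rows of the cut points form a three-term recurrence that [cosl] and [sinl] satisfy, so
a kernel vector is determined along an edge by its first two entries and is sampled from a
solution. *)
Lemma ker_sample y : y *m krein_mx k mu = 0 ->
  let a v := at_pt y (inl v) in let B e := (y_ y e 1 - cp e * y_ y e 0) / sp e in
  (forall e j, (j <= (k e).+1)%N -> y_ y e j = csol mu (a (ini e)) (B e) (node e j))
  /\ Krein_data mu a B.
Proof.
move=> yQ a B.
have at0 t : at_pt (y *m krein_mx k mu) t = 0 by rewrite yQ /at_pt mxE.
have H e j : (j <= k e)%N -> y_ y e j = csol mu (a (ini e)) (B e) (node e j) /\
   y_ y e j.+1 = csol mu (a (ini e)) (B e) (node e j.+1).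
  elim: j => [_|j IH jk].
    split; first by rewrite /node mul0r csol0.
    rewrite /csol /node mul1r /B /a; field; exact: sp_neq0.
  have [h1 h2] := IH (ltnW jk); split=> //.
  have := at0 (inner (Ordinal jk)); rewrite at_mul_krein_mx_inner /= /outflow /inflow h1 h2.
  rewrite csol_in => E1.
  have E2 := csol_out (a (ini e)) (B e) e j.+1.
  have : (cp e * csol mu (a (ini e)) (B e) (node e j.+1) - y_ y e j.+2) / sp e =
     (cp e * csol mu (a (ini e)) (B e) (node e j.+1) - csol mu (a (ini e)) (B e) (node e j.+2)) / sp e.
    by rewrite E2; apply/eqP; rewrite -addr_eq0 E1.
  have si : (sp e)^-1 != 0 by rewrite invr_eq0 sp_neq0.
  by move=> /(mulIf si) /addrI /oppr_inj.
have Y e j : (j <= (k e).+1)%N -> y_ y e j = csol mu (a (ini e)) (B e) (node e j).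
  by case: j => [_|j jk]; [have [] := H e 0|have [] := H e j].
split=> //; split=> [e|v].
  by rewrite -node_last -Y// pt_last.
have := at0 (inl v); rewrite at_mul_krein_mx_vertex => E0.
rewrite -[RHS]E0; congr (_ - _); apply: eq_bigr => e _.
  by rewrite /inflow !Y// csol_in node_last.
by rewrite /outflow !Y// csol_out opprK /node mul0r csol0.
Qed.

End Kernel.

(** * Multiplicities and the counting function *)

Section Dimension.
Context {R : realType} (G : metric_graph R) (k : edge G -> nat).
Notation C := R[i].
Notation V := (vertex G).
Notation E := (edge G).
Notation y_ y e j := (at_pt y (pt k e j)).
Notation leb := (@lebesgue_measure R).
Variable mu : R.
Hypothesis adm : forall e, Num.sqrt mu * piece k e < pi.
Hypothesis Gconn : connected_graph G.

Lemma ae_forall_fin m (P : 'I_m -> R -> Prop) :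
  (forall i, \forall x \ae leb, P i x) -> \forall x \ae leb, forall i, P i x.
Proof.
move=> H; have := @ae_foralln _ _ _ leb (fun n x => forall i : 'I_m, i = n :> nat -> P i x).
move=> H'; have {H'} : \forall x \ae leb, forall (n : nat) (i : 'I_m), i = n :> nat -> P i x.
  apply: H' => n; case: (ltnP n m) => [nm|mn].
    have := H (Ordinal nm); apply: ae_imp => x Px i iE.
    by have -> : i = Ordinal nm by exact: val_inj.
  by apply: aeW => x i iE; have := ltn_ord i; rewrite iE ltnNge mn.
by apply: ae_imp => x Hx i; exact: (Hx i i erefl).
Qed.

Lemma csol_sum m (c A B : 'I_m -> C) x :
  \sum_i c i * csol mu (A i) (B i) x =
  csol mu (\sum_i c i * A i) (\sum_i c i * B i) x.
Proof.
rewrite /csol !mulr_suml -big_split /=; apply: eq_bigr => i _; ring.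
Qed.

Lemma at_pt_mul m (v : 'rV[C]_m) (W : 'M[C]_(m, #|point k|)) t :
  at_pt (v *m W) t = \sum_i v 0 i * at_pt (row i W) t.
Proof. by rewrite /at_pt mxE; apply: eq_bigr => i _; rewrite mxE. Qed.

Lemma at_pt_eq0 (y : 'rV[C]_#|point k|) : (forall t, at_pt y t = 0) -> y = 0.
Proof. by move=> h; apply/rowP => i; rewrite -(enum_valK i) mxE; exact: h. Qed.

(** Sampling is linear and injective, since the first two samples on an edge give both initial
data; independent eigenfunctions therefore have independent samples. *)
Lemma eigenspace_dim_le m (F : 'I_m -> gfun G) :
  (forall i, Krein_eigenspace mu (F i)) -> L2_independent F ->
  (m <= #|null_set (krein_mx k mu)|)%N.
Proof.
move=> HF indF.
have /choice [a Ha] : forall i, exists a, exists B,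
    Krein_data mu a B /\ gfun_eq (F i) (eigfun mu a B).
  by move=> i; exact: Krein_data_of_eigenfunction (HF i).
have {Ha} /choice [B HB] := Ha.
pose W : 'M[C]_(m, #|point k|) := \matrix_i sample k mu (a i) (B i).
apply: (@dim_le_null _ _ _ (krein_mx_herm k mu) _ W); last first.
  by apply/row_matrixP => i; rewrite row_mul row0 rowK sample_ker//; exact: (HB i).1.
apply: inj_row_free => v vW.
have v0 t : \sum_i v 0 i * at_pt (sample k mu (a i) (B i)) t = 0.
  have h : at_pt (v *m W) t = 0 by rewrite vW /at_pt mxE.
  rewrite -[RHS]h at_pt_mul.
  by apply: eq_bigr => i _; rewrite rowK.
have a0 w : \sum_i v 0 i * a i w = 0.
  rewrite -[RHS](v0 (inl w)); apply: eq_bigr => i _.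
  by rewrite /at_pt mxE enum_rankK.
have B0 e : \sum_i v 0 i * B i e = 0.
  have := v0 (pt k e 1).
  under eq_bigr => i _ do rewrite (at_sample (HB i).1.1)//.
  rewrite csol_sum a0 /csol mul0r add0r => /eqP.
  by rewrite mulf_eq0 /node mul1r (negPf (sp_neq0 adm e)) orbF => /eqP.
apply/rowP => i; rewrite mxE.
apply: (indF (fun i => v 0 i)) => e.
have := @ae_forall_fin _ (fun i x => `]0, len e[%classic x -> F i e x = eigfun mu (a i) (B i) e x)
  (fun i => (HB i).2 e).
apply: ae_imp => x Hx xI.
under eq_bigr => j _ do rewrite Hx//.
by rewrite /eigfun csol_sum a0 B0 /csol !mul0r addr0.
Qed.

Lemma csol_ae0 (e : E) (A B : C) x :
  (\forall x \ae leb, `]0, len e[%classic x -> csol mu A B x = 0) ->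
  0 <= x <= len e -> csol mu A B x = 0.
Proof.
move=> h xe; rewrite -(Ctrace_smooth (u := fun=> 0) (len_gt0 e) (csmooth_csol mu A B) _ xe).
  have c0 : (fun=> 0) = csol mu 0 0.
    by apply/funext => y; rewrite /csol !mul0r addr0.
  rewrite (Ctrace_smooth (U := fun=> 0) (len_gt0 e) _ _ xe)//; last exact: aeW.
  by rewrite c0; exact: csmooth_csol.
by apply: ae_imp h => y /[apply] ->.
Qed.

(** A basis of the kernel is sampled from eigenfunctions; a linear relation between these holds
pointwise, hence between the samples. *)
Lemma eigenspace_dim_ge : exists F : 'I_#|null_set (krein_mx k mu)| -> gfun G,
  (forall i, Krein_eigenspace mu (F i)) /\ L2_independent F.
Proof.
have [W [fW WQ]] := null_subspace (krein_mx_herm k mu).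
pose y i := row i W.
have yQ i : y i *m krein_mx k mu = 0 by rewrite /y -row_mul WQ row0.
pose a i v := at_pt (y i) (inl v : point k).
pose B i e := (y_ (y i) e 1 - (cosl mu (piece k e))%:C%C * y_ (y i) e 0) / (sinl mu (piece k e))%:C%C.
have D i : _ /\ Krein_data mu (a i) (B i) := ker_sample adm (yQ i).
exists (fun i => eigfun mu (a i) (B i)); split=> [i|].
  by apply: eigenfunction_of_Krein_data; exact: (D i).2.
move=> c hc i.
have c0 t : \sum_i c i * at_pt (y i) t = 0.
  have H e j : (j <= (k e).+1)%N -> \sum_i c i * y_ (y i) e j = 0.
    move=> jk; under eq_bigr => i' _ do rewrite ((D i').1 e j jk).
    rewrite csol_sum; apply: (@csol_ae0 e).
      have := hc e; apply: ae_imp => x /[apply].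
      by rewrite /eigfun csol_sum.
    rewrite /node mulr_ge0 ?(ltW (piece_gt0 _ _))//=.
    by rewrite -[leRHS](piece_len k) ler_wpM2r ?(ltW (piece_gt0 _ _))// ler_nat.
  have [e [j [->|->]]] := point_incident Gconn t; apply: H => //.
  by rewrite ltnW.
pose v := \row_i c i.
have : v *m W = 0 *m W.
  rewrite mul0mx; apply: at_pt_eq0 => t; rewrite at_pt_mul -[RHS](c0 t).
  by apply: eq_bigr => j _; rewrite mxE.
by move/(row_free_inj fW)/rowP => /(_ i); rewrite !mxE.
Qed.

Lemma L2_dim_eigenspace :
  L2_dim (Krein_eigenspace (G := G) mu) = (#|null_set (krein_mx k mu)|%:R)%:E.
Proof.
apply/eqP; rewrite eq_le; apply/andP; split.
  apply: ge_ereal_sup => _ [m [F [HF indF]] <-].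
  by rewrite lee_fin ler_nat; exact: eigenspace_dim_le indF.
apply: ereal_sup_ubound; exists #|null_set (krein_mx k mu)| => //.
have [F HF] := eigenspace_dim_ge; by exists F.
Qed.

End Dimension.

Section Counting.
Context {R : realType} (G : metric_graph R).
Notation C := R[i].
Notation V := (vertex G).
Notation E := (edge G).
Hypothesis Gconn : connected_graph G.
Variable lam : R.
Hypothesis lam0 : 0 <= lam.

Lemma admissible_le k (mu : R) : (forall e, Num.sqrt lam * piece (G := G) k e < pi) ->
  mu <= lam -> forall e, Num.sqrt mu * piece k e < pi.
Proof. by move=> adm ml e; apply: sqrt_mul_lt ml _ (adm e); rewrite ltW ?piece_gt0. Qed.

Lemma counting_upper (k : E -> nat) :
  (forall e, Num.sqrt lam * piece k e < pi) ->
  (Krein_counting G lam <= (#|point k|%:R)%:E)%E.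
Proof.
move=> adm; apply: ge_ereal_sup => _ [A [finA Al] <-].
have [s us As] : exists2 s : seq R, uniq s & A = [set` s].
  have /finite_seqP [s ->] := finA; exists (undup s); first exact: undup_uniq.
  by apply/seteqP; split=> x /=; rewrite mem_undup.
rewrite As -fsbig_seq//.
have Hs mu : mu \in s -> mu <= lam by move=> ms; apply: Al; rewrite As.
rewrite big_seq (eq_bigr (fun mu => ((ev_null (krein_mx k) mu)%:R)%:E)); last first.
  by move=> mu /Hs ml; rewrite (L2_dim_eigenspace (admissible_le adm ml)).
rewrite -big_seq sumEFin lee_fin -natr_sum ler_nat.
apply: (@crossing_upper R _ (krein_mx k) lam) => //.
- exact: krein_mx_herm.
- by move=> *; apply: hform_krein_mx_decr.
Qed.

Lemma counting_lower (k : E -> nat) :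
  (forall e, Num.sqrt lam * piece k e < pi) ->
  (((ev_npos (krein_mx k) lam)%:R)%:E <= Krein_counting G lam)%E.
Proof.
move=> adm.
have [||s [us sl ps]] := @crossing_lower R _ (krein_mx k) lam lam0 (krein_mx_herm k).
- exact: hform_krein_mx0_ge0.
- by move=> mu eps ml e0; exact: hform_krein_mx_cont.
apply: (@le_trans _ _ (\sum_(mu <- s) L2_dim (Krein_eigenspace (G := G) mu))%E).
  rewrite big_seq (eq_bigr (fun mu => ((ev_null (krein_mx k) mu)%:R)%:E)); last first.
    by move=> mu /sl /andP[_ ml]; rewrite (L2_dim_eigenspace (admissible_le adm ml)).
  by rewrite -big_seq sumEFin lee_fin -natr_sum ler_nat.
apply: ereal_sup_ubound; exists [set` s].
  by split=> [|mu /= /sl /andP[]//]; exact: finite_seq.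
by rewrite -fsbig_seq.
Qed.

End Counting.

(** * The two subdivisions *)

Section Main.
Context {R : realType} (G : metric_graph R).
Notation C := R[i].
Notation V := (vertex G).
Notation E := (edge G).
Variable lam : R.

(** The number of eigenvalues at most [lam] of the Dirichlet Laplacian on [e]. *)
Definition dirichlet_count (e : E) : nat := Num.truncn (len e * Num.sqrt lam / pi).

Lemma dirichlet_count_itv e :
  (dirichlet_count e)%:R * pi <= Num.sqrt lam * len e <
  (dirichlet_count e).+1%:R * pi.
Proof.
have x0 : 0 <= len e * Num.sqrt lam / pi.
  by rewrite divr_ge0 ?pi_ge0// mulr_ge0 ?sqrtr_ge0// ltW// len_gt0.
have /andP[h1 h2] := truncn_itv x0.
by rewrite -ler_pdivlMr ?pi_gt0// -ltr_pdivrMr ?pi_gt0// [Num.sqrt lam * _]mulrC h1.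
Qed.

Lemma card_point (k : E -> nat) : #|point k| = (#|V| + \sum_(e : E) k e)%N.
Proof.
rewrite card_sum card_tagged sumnE big_map big_enum /=; congr (_ + _)%N.
by apply: eq_bigr => e _; rewrite card_ord.
Qed.

(** The number of cut points for [2 * dirichlet_count e] pieces, and 0 for an edge that is not
cut. *)
Definition odd_interior (e : E) : nat := (dirichlet_count e).*2.-1.

Lemma admissible_dirichlet_count e : Num.sqrt lam * piece dirichlet_count e < pi.
Proof.
have /andP[_ h] := dirichlet_count_itv e.
by rewrite /piece mulrA ltr_pdivrMr ?ltr0n// [pi * _]mulrC.
Qed.

Lemma admissible_odd_interior e : Num.sqrt lam * piece odd_interior e < pi.
Proof.
have /andP[_ h] := dirichlet_count_itv e.
rewrite /piece mulrA ltr_pdivrMr ?ltr0n//; apply: lt_le_trans h _.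
rewrite [pi * _]mulrC ler_wpM2r ?pi_ge0// ler_nat /odd_interior; lia.
Qed.

Definition odd_point := {e : E & 'I_(dirichlet_count e)}.

Lemma odd_ltn e (i : 'I_(dirichlet_count e)) : (i.*2 < odd_interior e)%N.
Proof.
rewrite /odd_interior; case: i => i /=; case: (dirichlet_count e) => [|d]; first by rewrite ltn0.
by rewrite ltnS => id; rewrite doubleS /= ltnS leq_double.
Qed.

(** The cut point of rank [2 i + 1]. *)
Definition odd_pt (o : odd_point) : point odd_interior :=
  inner (Ordinal (odd_ltn (tagged o))).

Lemma odd_pt_inj : injective odd_pt.
Proof.
move=> [e i] [e' i'] h.
have /eqP := h; rewrite {1}/odd_pt -pt_inner pt_eq_inner /= => /andP[/eqP ee].
case: _ / ee i' h => i' _; rewrite eqSS -!mul2n eqn_mul2l /= => /eqP ii.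
by congr (Tagged _ _); exact: val_inj.
Qed.

Hypothesis lam0 : 0 <= lam.

(** On the coordinate subspace of the points of odd rank the form is diagonal: every piece has at
most one end in that set. The diagonal entries are nonpositive because a piece has length at
least half of pi / sqrt lam. *)
Lemma npos_lower : (\sum_(e : E) dirichlet_count e <= ev_npos (krein_mx odd_interior) lam)%N.
Proof.
have -> : (\sum_(e : E) dirichlet_count e)%N = #|{: odd_point}|.
  rewrite card_tagged sumnE big_map big_enum /=.
  by apply: eq_bigr => e _; rewrite card_ord.
pose W : 'M[C]_(#|{: odd_point}|, #|point odd_interior|) :=
  \matrix_i delta_pt (odd_pt (enum_val i)).
have at_vW (v : 'rV[C]_#|{: odd_point}|) t : at_pt (v *m W) t =
    \sum_i v 0 i * (odd_pt (enum_val i) == t)%:R.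
  by rewrite at_pt_mul; apply: eq_bigr => i _; rewrite rowK at_delta_pt.
apply: (@dim_le_npos _ _ _ (krein_mx_herm _ lam) _ W) => [|v].
  apply: inj_row_free => v vW; apply/rowP => i; rewrite mxE.
  have : at_pt (v *m W) (odd_pt (enum_val i)) = 0 by rewrite vW /at_pt mxE.
  rewrite at_vW (bigD1 i)//= eqxx mulr1 big1 ?addr0// => j ji.
  by rewrite (inj_eq odd_pt_inj) (inj_eq enum_val_inj) (negPf ji) mulr0.
set y := v *m W.
have yv w : at_pt y (inl w) = 0 by rewrite at_vW big1// => i _; rewrite mulr0.
have ye e j : ~~ odd j -> (j <= (odd_interior e).+1)%N -> at_pt y (pt odd_interior e j) = 0.
  move=> jo jk; rewrite at_vW big1// => i _.
  rewrite eq_sym /odd_pt pt_eq_inner; case: eqP => //= _; last by rewrite mulr0.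
  by case: eqP => [jE|]; rewrite ?mulr0//; move: jo; rewrite jE /= odd_double.
rewrite hform_krein_mx sumr_le0// => e _.
have sqn0 : sqn (0 : C) = 0 by rewrite /sqn /= expr0n addr0.
have sqnN (z : C) : sqn (- z) = sqn z by rewrite /sqn cReN cImN !sqrrN.
rewrite pt_last pt0 !yv subrr sqn0 mulr0 subr0.
rewrite sumr_le0// => j' _; move: (nat_of_ord j') (ltn_ord j') => j jlt.
(* z is the value at the end of odd rank; for an uncut edge both ends are vertices. *)
have [z Ez z0] : exists2 z : C,
    sqn (at_pt y (pt odd_interior e j) - at_pt y (pt odd_interior e j.+1)) = sqn z /\
    sqn (at_pt y (pt odd_interior e j) + at_pt y (pt odd_interior e j.+1)) = sqn z &
    dirichlet_count e = 0%N -> z = 0.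
  have [jo|je] := boolP (odd j).
    exists (at_pt y (pt odd_interior e j)).
      have -> : at_pt y (pt odd_interior e j.+1) = 0.
        by apply: ye; [rewrite /= jo|].
      by rewrite subr0 addr0.
    by move=> De; move: jlt; rewrite /odd_interior De /= ltnS leqn0 => /eqP j0; move: jo; rewrite j0.
  exists (at_pt y (pt odd_interior e j.+1)).
    have -> : at_pt y (pt odd_interior e j) = 0 by apply: ye => //; exact: ltnW.
    by rewrite sub0r add0r sqnN.
  move=> De; have -> : j.+1 = (odd_interior e).+1.
    by move: jlt; rewrite /odd_interior De /= ltnS leqn0 => /eqP ->.
  by rewrite pt_last yv.
move: Ez => [-> ->].
have [De|De] := posnP (dirichlet_count e); first by rewrite z0// sqn0 !mulr0 subr0.
have p0 := piece_gt0 odd_interior e; have ad := admissible_odd_interior e.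
have s0 := sinl_gt0 p0 ad.
have c0 : cosl lam (piece odd_interior e) <= 0.
  apply: cosl_le0 => //; rewrite (ltW ad) andbT.
  have /andP[h _] := dirichlet_count_itv e.
  have k2 : (odd_interior e).+1 = (dirichlet_count e).*2 by rewrite /odd_interior; lia.
  rewrite /piece k2 mulrA ler_pdivlMr ?ltr0n ?double_gt0//.
  by apply: le_trans h; rewrite -mul2n natrM; lra.
rewrite -mulrBl mulr_le0_ge0 ?sqn_ge0//.
rewrite (_ : _ - _ = cosl lam (piece odd_interior e) / sinl lam (piece odd_interior e)).
  by rewrite pmulr_lle0 ?invr_gt0.
by rewrite /qdiff /qsum; field; rewrite gt_eqF.
Qed.

End Main.

Theorem corollary3p10 (R : realType) (G : metric_graph R)
    (Gconn : connected_graph G) (lambda : R) (lambda_ge0 : 0 <= lambda) :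
  ((total_length G / pi * Num.sqrt lambda - #|edge G|%:R)%:E
     <= Krein_counting G lambda)%E /\
  (Krein_counting G lambda
     <= (total_length G / pi * Num.sqrt lambda + #|vertex G|%:R)%:E)%E.
Proof.
split.
  apply: (le_trans _ (counting_lower Gconn lambda_ge0 (admissible_odd_interior lambda))).
  rewrite lee_fin; apply: (@le_trans _ _ (\sum_(e : edge G) dirichlet_count lambda e)%:R); last first.
    by rewrite ler_nat npos_lower.
  rewrite natr_sum lerBlDr -sum1_card natr_sum -big_split /=.
  rewrite /total_length !mulr_suml; apply: ler_sum => e _.
  have /andP[_ h] := dirichlet_count_itv lambda e.
  rewrite natr1 mulrAC ler_pdivrMr ?pi_gt0// mulrC ltW//.
apply: (le_trans (counting_upper Gconn (admissible_dirichlet_count lambda))).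
rewrite lee_fin card_point natrD addrC lerD2r natr_sum /total_length !mulr_suml.
apply: ler_sum => e _; have /andP[h _] := dirichlet_count_itv lambda e.
by rewrite mulrAC ler_pdivlMr ?pi_gt0// [len e * _]mulrC.
Qed.
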